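(* For any $n\ge 3$, the commutator subgroup $WB_n'=[WB_n,WB_n]$ of the welded braid group $WB_n$ is Hopfian.
   Context: The welded braid group $WB_n$ is the group with generators $\sigma_i,\rho_i$ ($1\le i\le n-1$) and the following defining relations (for all indices for which they make sense): braid relations $\sigma_i\sigma_j=\sigma_j\sigma_i$ if $|i-j|>1$, $\sigma_i\sigma_{i+1}\sigma_i=\sigma_{i+1}\sigma_i\sigma_{i+1}$; symmetric relations $\rho_i^2=1$, $\rho_i\rho_j=\rho_j\rho_i$ if $|i-j|>1$, $\rho_i\rho_{i+1}\rho_i=\rho_{i+1}\rho_i\rho_{i+1}$; mixed relations $\sigma_i\rho_j=\rho_j\sigma_i$ if $|i-j|>1$, $\rho_i\rho_{i+1}\sigma_i=\sigma_{i+1}\rho_i\rho_{i+1}$; forbidden relations $\rho_i\sigma_{i+1}\sigma_i=\sigma_{i+1}\sigma_i\rho_{i+1}$. A group $G$ is Hopfian if every epimorphism $G\to G$ is an isomorphism. *)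

(* Defs.v *)
From HB Require Import structures.
From mathcomp Require Import all_boot.
From mathcomp Require Import boolp.

Set Implicit Arguments.
Unset Strict Implicit.
Unset Printing Implicit Defensive.

Local Open Scope quotient_scope.
Local Open Scope group_scope.

(* Words in the letters x and x^-1 for x : X: (x, false) stands for x and
   (x, true) for x^-1. *)
Definition word (X : Type) := seq (X * bool).

Definition inv_letter (X : Type) (a : X * bool) : X * bool := (a.1, ~~ a.2).

Definition inv_word (X : Type) (w : word X) : word X :=
  rev (map (@inv_letter X) w).

(* The least congruence on words that contains the relations R and free
   cancellation; the words modulo it form the group < X | R >. *)
Inductive word_eq (X : Type) (R : word X -> word X -> Prop) :
  word X -> word X -> Prop :=
| WordRel u v : R u v -> word_eq R u v
| WordCancel a : word_eq R [:: a; inv_letter a] [::]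
| WordRefl u : word_eq R u u
| WordSym u v : word_eq R u v -> word_eq R v u
| WordTrans u v w : word_eq R u v -> word_eq R v w -> word_eq R u w
| WordCat u u' v v' :
    word_eq R u u' -> word_eq R v v' -> word_eq R (u ++ v) (u' ++ v').

Section Presentation.
Variables (X : choiceType) (R : word X -> word X -> Prop).

Definition word_eqb : rel (word X) := fun u v => `[< word_eq R u v >].

Lemma word_eqb_refl : reflexive word_eqb.
Proof. by move=> u; apply/asboolP/WordRefl. Qed.

Lemma word_eqb_sym : symmetric word_eqb.
Proof.
by move=> u v; apply/asboolP/asboolP => /WordSym.
Qed.

Lemma word_eqb_trans : transitive word_eqb.
Proof.
by move=> v u w /asboolP uv /asboolP vw; apply/asboolP/(WordTrans uv).
Qed.

Canonical word_equiv :=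
  EquivRel word_eqb word_eqb_refl word_eqb_sym word_eqb_trans.

Definition presented_group := {eq_quot word_equiv}.

HB.instance Definition _ := Choice.copy presented_group {eq_quot word_equiv}.

Definition word_class (w : word X) : presented_group := \pi_{eq_quot word_equiv} w.

Definition presented_one : presented_group := word_class [::].

Definition presented_mul (x y : presented_group) : presented_group :=
  word_class (repr x ++ repr y).

Definition presented_inv (x : presented_group) : presented_group :=
  word_class (inv_word (repr x)).

Definition presented_gen (x : X) : presented_group := word_class [:: (x, false)].

Lemma word_classP u v : word_class u = word_class v <-> word_eq R u v.
Proof. by split=> [/eqmodP/asboolP|/asboolP uv]; last exact/eqmodP. Qed.

Lemma repr_word_class u : word_eq R (repr (word_class u)) u.
Proof. by apply/word_classP; rewrite /word_class reprK. Qed.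

Lemma word_class_repr (x : presented_group) : word_class (repr x) = x.
Proof. exact: reprK. Qed.

Lemma inv_letterK : involutive (@inv_letter X).
Proof. by case=> x b; rewrite /inv_letter negbK. Qed.

Lemma inv_word_cat (u v : word X) :
  inv_word (u ++ v) = inv_word v ++ inv_word u.
Proof. by rewrite /inv_word map_cat rev_cat. Qed.

Lemma inv_wordK : involutive (@inv_word X).
Proof.
by move=> u; rewrite /inv_word map_rev revK mapK //; apply: inv_letterK.
Qed.

Lemma word_cancel u : word_eq R (u ++ inv_word u) [::].
Proof.
elim: u => [|a u IHu]; first exact: WordRefl.
have aua : word_eq R ([:: a] ++ u ++ inv_word u) [:: a].
  by have := WordCat (WordRefl R [:: a]) IHu; rewrite cats0.
rewrite -cat1s inv_word_cat catA -(catA _ u).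
exact: WordTrans (WordCat aua (WordRefl R _)) (WordCancel R a).
Qed.

Lemma word_class_cat u v :
  word_class (u ++ v) = presented_mul (word_class u) (word_class v).
Proof.
by apply/word_classP/WordSym/WordCat; apply: repr_word_class.
Qed.

Lemma presented_mulA : associative presented_mul.
Proof.
move=> x y z; rewrite -(word_class_repr x) -(word_class_repr y).
by rewrite -(word_class_repr z) -!word_class_cat catA.
Qed.

Lemma presented_mul1 : left_id presented_one presented_mul.
Proof. by move=> x; rewrite -(word_class_repr x) -word_class_cat. Qed.

Lemma presented_mulr1 : right_id presented_one presented_mul.
Proof. by move=> x; rewrite -(word_class_repr x) -word_class_cat cats0. Qed.

Lemma presented_mulV : right_inverse presented_one presented_inv presented_mul.
Proof.
move=> x; rewrite -[X in presented_mul X](word_class_repr x) -word_class_cat.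
by apply/word_classP/word_cancel.
Qed.

Lemma presented_mulVl : left_inverse presented_one presented_inv presented_mul.
Proof.
move=> x; rewrite -[X in presented_mul _ X](word_class_repr x).
rewrite -word_class_cat; apply/word_classP.
by rewrite -{2}(inv_wordK (repr x)); apply: word_cancel.
Qed.

HB.instance Definition _ := isGroup.Build presented_group
  presented_mulA presented_mul1 presented_mulr1 presented_mulVl presented_mulV.

End Presentation.

(* Generator indices are shifted by one: i : 'I_n.-1 stands for i + 1, with
   1 <= i + 1 <= n - 1. *)
Definition wb_gen n : Type := ('I_n.-1 + 'I_n.-1)%type.
HB.instance Definition _ n := Choice.on (wb_gen n).

Definition sigma_letter n (i : 'I_n.-1) : wb_gen n * bool := (inl i, false).
Definition rho_letter n (i : 'I_n.-1) : wb_gen n * bool := (inr i, false).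

(* |i - j| > 1 *)
Definition far_apart n (i j : 'I_n) : bool := (i.+1 < j) || (j.+1 < i).

Section WeldedBraidRelations.
Variable n : nat.
Local Notation s := (@sigma_letter n).
Local Notation r := (@rho_letter n).

Inductive wb_rel : word (wb_gen n) -> word (wb_gen n) -> Prop :=
| BraidFar (i j : 'I_n.-1) of far_apart i j :
    wb_rel [:: s i; s j] [:: s j; s i]
| BraidNear (i j : 'I_n.-1) of j = i.+1 :> nat :
    wb_rel [:: s i; s j; s i] [:: s j; s i; s j]
| SymSquare (i : 'I_n.-1) :
    wb_rel [:: r i; r i] [::]
| SymFar (i j : 'I_n.-1) of far_apart i j :
    wb_rel [:: r i; r j] [:: r j; r i]
| SymNear (i j : 'I_n.-1) of j = i.+1 :> nat :
    wb_rel [:: r i; r j; r i] [:: r j; r i; r j]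
| MixedFar (i j : 'I_n.-1) of far_apart i j :
    wb_rel [:: s i; r j] [:: r j; s i]
| MixedNear (i j : 'I_n.-1) of j = i.+1 :> nat :
    wb_rel [:: r i; r j; s i] [:: s j; r i; r j]
| Forbidden (i j : 'I_n.-1) of j = i.+1 :> nat :
    wb_rel [:: r i; s j; s i] [:: s j; s i; r j].
End WeldedBraidRelations.

Definition welded_braid_group n : groupType := presented_group (@wb_rel n).

Inductive generated (G : groupType) (A : G -> Prop) : G -> Prop :=
| GenIn x : A x -> generated A x
| Gen1 : generated A 1
| GenM x y : generated A x -> generated A y -> generated A (x * y)
| GenV x : generated A x -> generated A x^-1.

Section CommutatorSubgroup.
Variable G : groupType.

Definition is_commutator (z : G) : Prop := exists x y : G, z = [~ x, y].

Definition derived : {pred G} := fun x => `[< generated is_commutator x >].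

Lemma derived_closed : group_closed derived.
Proof.
split=> [|x y /asboolP Gx /asboolP Gy]; apply/asboolP; first exact: Gen1.
exact/GenM/GenV.
Qed.

Definition commutator_subgroup : Type := {x : G | x \in derived}.

HB.instance Definition _ := SubChoice.on commutator_subgroup.
HB.instance Definition _ :=
  SubChoice_isSubGroup.Build G derived commutator_subgroup derived_closed.

End CommutatorSubgroup.

Definition hopfian (G : groupType) : Prop :=
  forall f : {multiplicative G -> G},
    (forall y : G, exists x : G, f x = y) -> bijective f.

(* Main.v *)
Require Import Defs.
From HB Require Import structures.
From mathcomp Require Import all_boot.
From mathcomp Require Import fingroup perm generic_quotient.
From mathcomp Require Import boolp.
From mathcomp Require Import zify.
Import Defs.

(** A finitely generated residually finite group is Hopfian (Malcev), so it
    suffices to see that WB_n' is finitely generated and that WB_n is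
    residually finite, a property that subgroups inherit.

    Residual finiteness. For every group H, WB_n acts on the right on n-tuples of
    elements of H: rho_k exchanges the entries y_k and y_k+1, and sigma_k
    replaces (y_k, y_k+1) by (y_k+1, y_k+1^-1 y_k y_k+1). For finite H these are
    finite quotients of WB_n. They separate its elements because (1) the action
    on tuples over a free group is faithful and (2) a conjugate of a free
    generator that differs from this generator is told apart from it in a finite
    group of permutations of cosets (conjugate_detected).

    For (1), WB_n is generated by a copy of the symmetric group and by the pure
    generators alpha i j, which conjugate y_i by y_j and satisfy McCool's
    relations (alpha_far, alpha_same_target, alpha_triangle). Write
    y_i = w_i^-1 x_i w_i with w_i reduced and not beginning with x_i. A pure
    generator or its inverse always changes the total length of the w_i, and it
    shortens w_i exactly when w_i ends with x_j^-1 w_j, respectively x_j w_j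
    (run_loop_cases). As suffixes of one word are nested, two shortening moves of
    the same tuple can always be completed to an instance of one of McCool's
    relations that stays below that tuple (pure_peak). By descending induction,
    as in Newman's lemma, a product of pure generators that fixes a tuple is then
    trivial in WB_n (free_action, pure_faithful). The same principle, with
    permutations in place of tuples and descents in place of shortenings, shows
    that the rho_k generate a copy of the symmetric group (rho_word_perm), which
    is needed to define alpha i j for all i and j.

    Finite generation. All alpha i j have the same image in the abelianization
    of WB_n. Let K be generated by the products rho_j rho_k, by the quotients
    of two pure generators and by the conjugates of these quotients by one pure
    generator p. All these are commutators. The point is that p^2 normalises K:
    the square of alpha i j is the product of alpha i j alpha k j, which
    commutes with alpha i k and with alpha k j, and of a quotient of pure
    generators. For n >= 3 this links all pure generators to each other
    (alpha_connected). So K is normal, and modulo K the group is generated by p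
    and rho_1, which commute; hence K is the commutator subgroup
    (derived_generated). *)

Set Implicit Arguments.
Unset Strict Implicit.
Unset Printing Implicit Defensive.

Local Open Scope group_scope.

(** * Finitely generated residually finite groups are Hopfian *)

Definition finitely_generated (G : groupType) : Prop :=
  exists L : seq G, forall x : G, generated (fun y => y \in L) x.

Definition residually_finite (G : groupType) : Prop :=
  forall x : G, x <> 1 ->
  exists (Q : finGroupType) (f : {multiplicative G -> Q}), f x <> 1.

Lemma multiplicative1 (G H : groupType) (f : {multiplicative G -> H}) : f 1 = 1.
Proof. by apply: (@mulgI _ (f 1)); rewrite -gmulfM !mulg1. Qed.

Lemma multiplicativeV (G H : groupType) (f : {multiplicative G -> H}) x :
  f x^-1 = (f x)^-1.
Proof.
by apply: (@mulIg _ (f x)); rewrite -gmulfM !mulVg multiplicative1.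
Qed.

Lemma eq_on_generated (G H : groupType) (f g : {multiplicative G -> H})
    (A : G -> Prop) :
  (forall x, A x -> f x = g x) -> forall x, generated A x -> f x = g x.
Proof.
move=> fg x; elim=> {x} [x /fg //||x y _ fgx _ fgy|x _ fgx].
- by rewrite !multiplicative1.
- by rewrite !gmulfM fgx fgy.
- by rewrite !multiplicativeV fgx.
Qed.

Fixpoint iter_mult (G H : groupType) (f : {multiplicative G -> G})
    (p : {multiplicative G -> H}) k : {multiplicative G -> H} :=
  if k is k'.+1 then iter_mult f p k' \o f else p.

Lemma iter_multD (G H : groupType) (f : {multiplicative G -> G})
    (p : {multiplicative G -> H}) k x :
  iter_mult f p k x = p (iter k f x).
Proof. by elim: k x => //= k IHk x; rewrite IHk -iterSr. Qed.

(** A finitely generated group has finitely many homomorphisms to a given finite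
    group, so p o f^k = p o f^l for some k < l. If f killed an element that p
    detects, a preimage of this element under f^k would be sent to the element
    itself by f^k but to 1 by f^l. *)
Theorem malcev_hopfian (G : groupType) :
  finitely_generated G -> residually_finite G -> hopfian G.
Proof.
move=> [L genL] rfG f surj_f.
have inj_f : injective f.
  move=> x y fxy; apply: contrapT => /eqP; rewrite -divg_eq1 => /eqP xy1.
  have [Q [p pxy]] := rfG _ xy1.
  pose F (k : 'I_#|{: (size L).-tuple Q}|.+1) : (size L).-tuple Q :=
    map_tuple (iter_mult f p k) (in_tuple L).
  have /injectivePn[k [l kl Fkl]] : ~~ injectiveb F.
    by apply/negP => /injectiveP /leq_card; rewrite card_ord ltnn.
  wlog {kl} kl : k l Fkl / (k < l)%N.
    move=> H; case: (ltngtP k l) => [|lk|/ord_inj /eqP]; first exact: H.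
      exact: (H l k).
    by rewrite (negPf kl).
  have eqkl z : p (iter k f z) = p (iter l f z).
    rewrite -!iter_multD; apply: eq_on_generated (genL z) => w wL.
    by have /eq_in_map/(_ w wL) := congr1 val Fkl.
  have surj_iter i z : exists w, iter i f w = z.
    elim: i z => [|i IHi] z; first by exists z.
    by have [w1 <-] := surj_f z; have [w2 <-] := IHi w1; exists w2.
  (* The element to be detected is x / y, which f kills. *)
  have [z zk] := surj_iter k (x / y).
  apply: pxy; rewrite -zk eqkl -(subnKC kl) addSnnS addnC iterD zk.
  have f1 : f (x / y) = 1 by rewrite gmulfM multiplicativeV fxy mulgV.
  rewrite iterSr f1 -iter_multD; exact: multiplicative1.
have [g fg] := choice surj_f.
by exists g => // x; apply: inj_f.
Qed.

(** * Homomorphisms out of a presented group *)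

Definition eval_letter (X : Type) (H : groupType) (f : X -> H) (a : X * bool) : H :=
  if a.2 then (f a.1)^-1 else f a.1.

Definition eval_word (X : Type) (H : groupType) (f : X -> H) (w : word X) : H :=
  foldr (fun a x => eval_letter f a * x) 1 w.

Lemma eval_cat (X : Type) (H : groupType) (f : X -> H) (u v : word X) :
  eval_word f (u ++ v) = eval_word f u * eval_word f v.
Proof. by elim: u => [|a u IHu] /=; rewrite ?mul1g // IHu mulgA. Qed.

Lemma eval_inv_letter (X : Type) (H : groupType) (f : X -> H) a :
  eval_letter f (inv_letter a) = (eval_letter f a)^-1.
Proof. by case: a => x []; rewrite /eval_letter /= ?invgK. Qed.

Section PresentedHom.
Variables (X : choiceType) (R : word X -> word X -> Prop) (H : groupType).
Variable f : X -> H.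
Hypothesis Rf : forall u v, R u v -> eval_word f u = eval_word f v.

Lemma eval_word_eq u v : word_eq R u v -> eval_word f u = eval_word f v.
Proof.
elim=> {u v} //.
- by move=> a; rewrite /= eval_inv_letter mulg1 mulgV.
- by move=> u v w _ -> _ ->.
- by move=> u u' v v' _ uu' _ vv'; rewrite !eval_cat uu' vv'.
Qed.

Definition presented_hom (x : presented_group R) : H := eval_word f (repr x).

Lemma presented_hom_class w : presented_hom (word_class R w) = eval_word f w.
Proof. exact/eval_word_eq/repr_word_class. Qed.

Lemma presented_homM : {morph presented_hom : x y / x * y}.
Proof.
move=> x y; rewrite -(word_class_repr x) -(word_class_repr y).
rewrite -[_ * _]word_class_cat !presented_hom_class; exact: eval_cat.
Qed.

Lemma presented_hom_gen x : presented_hom (presented_gen R x) = f x.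
Proof. by rewrite presented_hom_class /= mulg1. Qed.

End PresentedHom.

Lemma class_eval (X : choiceType) (R : word X -> word X -> Prop) (w : word X) :
  word_class R w = eval_word (presented_gen R) w.
Proof.
elim: w => [//|a w IHw].
rewrite -cat1s word_class_cat /= -IHw; congr presented_mul.
case: a => x [] //.
have -> : [:: (x, true)] = inv_word [:: (x, false)] by [].
rewrite /eval_letter /=; apply: esym; apply: mulg1_eq.
rewrite -[LHS]word_class_cat; exact/word_classP/word_cancel.
Qed.

Lemma presented_ind (X : choiceType) (R : word X -> word X -> Prop)
    (P : presented_group R -> Prop) :
  P 1 -> (forall g x, P g -> P (g * presented_gen R x)) ->
  (forall g x, P g -> P (g * (presented_gen R x)^-1)) -> forall g, P g.
Proof.
move=> P1 Pg PV g; rewrite -(word_class_repr g) class_eval.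
elim/last_ind: (repr g) => [//|w [x b] IHw]; rewrite -cats1 eval_cat /= mulg1.
by case: b; [apply: PV | apply: Pg].
Qed.

(** * Words that act freely *)

Section Descent.
Variables (X S : Type) (act : X -> S -> X) (W : groupType) (h : S -> W).
Variables (valid : X -> Prop) (mu : X -> nat) (inv : S -> S).

Fixpoint below k x (u : seq S) : Prop :=
  if u is s :: u' then (mu (act x s) < k)%N /\ below k (act x s) u' else True.

Definition word_value (u : seq S) : W := foldr (fun s g => h s * g) 1 u.

Lemma word_value_cat u v : word_value (u ++ v) = word_value u * word_value v.
Proof. by elim: u => [|s u IHu] /=; rewrite ?mul1g // IHu mulgA. Qed.

Lemma below_cat k x u v :
  below k x (u ++ v) = (below k x u /\ below k (foldl act x u) v) :> Prop.
Proof.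
elim: u x => [|s u IHu] x /=; apply/propext; first by split=> [|[]].
by rewrite IHu; split=> [[? []]|[[]]].
Qed.

Hypothesis act_valid : forall x s, valid x -> valid (act x s).
Hypothesis actK : forall x s, valid x -> act (act x s) (inv s) = x.
Hypothesis h_inv : forall s, h (inv s) = (h s)^-1.

(** Local confluence: the ends of two edges at x are joined below x, by a word
    that has the value required for the relation around this loop. *)
Definition bypass x s t := exists u, [/\ below (mu x) (act x s) u,
  foldl act (act x s) u = act x t & h s * word_value u = h t].

Lemma below_reverse k x u : valid x -> (mu x < k)%N -> below k x u ->
  exists v, [/\ below k (foldl act x u) v, foldl act (foldl act x u) v = x
              & word_value v = (word_value u)^-1].
Proof.
elim: u x => [|s u IHu] x vx xk /=; first by exists [::]; rewrite invg1.
case=> sk /(IHu _ (act_valid s vx) sk)[v [bv ev hv]].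
exists (v ++ [:: inv s]); rewrite below_cat foldl_cat ev word_value_cat hv /= actK //.
by rewrite mulg1 h_inv invgM; split=> //; rewrite bv xk.
Qed.

Lemma bypass_sym x s t : valid x -> (mu (act x s) < mu x)%N ->
  bypass x s t -> bypass x t s.
Proof.
move=> vx xs [u [bu eu hu]].
have [v [bv ev hv]] := below_reverse (act_valid s vx) xs bu.
rewrite eu in bv ev; exists v; split=> //.
by rewrite hv -hu mulgK.
Qed.

Hypothesis mu_neq : forall x s, valid x -> mu (act x s) <> mu x.
Hypothesis peak : forall x s t, valid x ->
  (mu (act x s) < mu x)%N -> (mu (act x t) < mu x)%N -> bypass x s t.

(** Every local minimum gets the value 1: only the differences along the edges
    matter. *)
Inductive descends : X -> W -> Prop :=
| DescendStop x : (forall s, ~ (mu (act x s) < mu x)%N) -> descends x 1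
| DescendStep x s g : (mu (act x s) < mu x)%N -> descends (act x s) g ->
    descends x (g * (h s)^-1).

Lemma descends_exists x : exists g, descends x g.
Proof.
have [k] := ubnP (mu x); elim: k x => // k IHk x xk.
have [[s xs]|nx] := pselect (exists s, mu (act x s) < mu x)%N.
  have [|g gx] := IHk (act x s); first exact: leq_trans xs _.
  by exists (g * (h s)^-1); apply: DescendStep.
by exists 1; apply: DescendStop => s xs; apply: nx; exists s.
Qed.

Let functional_below k := forall x g g', valid x -> (mu x < k)%N ->
  descends x g -> descends x g' -> g = g'.

Lemma descends_edge k x s g : functional_below k -> valid x ->
  (mu x < k)%N -> descends x g -> descends (act x s) (g * h s).
Proof.
move=> fk vx xk gx; have [lt|gt|/mu_neq//] := ltngtP (mu (act x s)) (mu x).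
  have [g' gx'] := descends_exists (act x s).
  by rewrite (fk _ _ _ vx xk gx (DescendStep lt gx')) mulgVK.
have := @DescendStep (act x s) (inv s) g; rewrite actK // h_inv invgK.
exact.
Qed.

Lemma descends_path k x u g : functional_below k -> valid x ->
  (mu x < k)%N -> below k x u -> descends x g ->
  descends (foldl act x u) (g * word_value u).
Proof.
move=> fk; elim: u x g => [|s u IHu] x g vx xk /=; first by rewrite mulg1.
case=> xsk bu gx; rewrite mulgA; apply: IHu => //; first exact: act_valid.
exact: descends_edge fk vx xk gx.
Qed.

(** Two descents from x may start with different steps; the bypass lies below x,
    where values are already unique, and carries one value to the other. *)
Lemma descends_functional k : functional_below k.
Proof.
elim: k => // k IHk x g g' vx xk gx; rewrite ltnS in xk.
case: {x g} gx vx xk => [x stop _ _ gx'|x s g xs gs vx xk gx'].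
  by case: gx' stop => // {}x s g'' xs _ /(_ s).
case: gx' xs gs vx xk => {x g'} [x stop /stop//|x t g' xt gt xs gs vx xk].
have [u [bu eu hu]] := peak vx xs xt.
have fx : functional_below (mu x).
  by move=> y *; apply: (IHk y) => //; apply: leq_trans xk.
have vs := act_valid s vx.
have := descends_path fx vs xs bu gs; rewrite eu => gt'.
rewrite (fx _ _ _ (act_valid t vx) xt gt gt') -hu invgM mulgA mulgK.
by [].
Qed.

(** The value of a descent is multiplied by h s along every edge s, so it
    recovers the value of a word from the ends of its path. *)
Theorem free_action x u v : valid x -> foldl act x u = foldl act x v ->
  word_value u = word_value v.
Proof.
move=> vx uv; have [g gx] := descends_exists x.
have path w : descends (foldl act x w) (g * word_value w).
  have [k bw xk] : exists2 k, below k x w & (mu x < k)%N.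
    elim: w x {vx uv gx} => [|s w IHw] x; first by exists (mu x).+1.
    have [k bw xk] := IHw (act x s); exists (maxn k (mu x).+1) => /=; last lia.
    split; first lia; move: bw; elim: (w) (act x s) => //= t w' IHw' y [yk bw].
    by split; [lia | exact: IHw'].
  exact: descends_path (@descends_functional k) vx xk bw gx.
have pu := path u; have pv := path v; rewrite uv in pu.
apply: (@mulgI _ g); apply: (descends_functional (k := (mu (foldl act x v)).+1)) pu pv => //.
by elim: v {path uv} x vx {gx} => //= s v IHv x vx; apply/IHv/act_valid.
Qed.

End Descent.

Lemma perm_extension (T : finType) (s t : seq T) :
  uniq s -> uniq t -> size s = size t -> exists p : {perm T}, map p s = t.
Proof.
elim: s t => [|x s IHs] [|y t] //=; first by exists 1.
move=> /andP[xs us] /andP[yt ut] [/(IHs t us ut)[p pt]].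
exists (p * tperm (p x) y); rewrite permM tpermL -{}pt in yt *.
congr (_ :: _); apply/eq_in_map => z zs; rewrite permM tpermD //.
  by apply: contraNneq xs => /perm_inj ->.
by apply: contraNneq yt => ->; apply: map_f.
Qed.

Ltac split_ifs :=
  repeat match goal with
  | |- context [if ?b then _ else _] =>
      lazymatch b with context [if _ then _ else _] => fail | _ => case: (boolP b) => ? end
  end.

(** * The symmetric group inside the welded braid group *)

Section WeldedBraids.
Variable m : nat.
Local Notation n := m.+2.
Local Notation W := (welded_braid_group n).

Definition sigma (k : 'I_m.+1) : W := presented_gen (@wb_rel n) (inl k).
Definition rho (k : 'I_m.+1) : W := presented_gen (@wb_rel n) (inr k).

Lemma relation_eval u v : wb_rel u v ->
  eval_word (presented_gen (@wb_rel n)) u = eval_word (presented_gen (@wb_rel n)) v.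
Proof. by move=> uv; rewrite -!class_eval; apply/word_classP/WordRel. Qed.

Lemma rhoK k : rho k * rho k = 1.
Proof. by have := relation_eval (@SymSquare n k); rewrite /= !mulg1. Qed.

Lemma mul_rhoK x k : x * rho k * rho k = x.
Proof. by rewrite -mulgA rhoK mulg1. Qed.

Lemma rhoV k : (rho k)^-1 = rho k.
Proof. exact: mulg1_eq (rhoK k). Qed.

Lemma rho_far (j k : 'I_m.+1) : far_apart j k -> rho j * rho k = rho k * rho j.
Proof. by move=> /(@SymFar n)/relation_eval; rewrite /= !mulg1. Qed.

Lemma rho_near (j k : 'I_m.+1) : k = j.+1 :> nat ->
  rho j * rho k * rho j = rho k * rho j * rho k.
Proof. by move=> /(@SymNear n)/relation_eval; rewrite /= !mulg1 -!mulgA. Qed.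

Lemma mul_rho_near x (j k : 'I_m.+1) : k = j.+1 :> nat ->
  x * rho j * rho k * rho j = x * rho k * rho j * rho k.
Proof. by move=> jk; rewrite -!mulgA (mulgA (rho j)) (rho_near jk) !mulgA. Qed.

Lemma sigma_rho_far (j k : 'I_m.+1) : far_apart j k ->
  sigma j * rho k = rho k * sigma j.
Proof. by move=> /(@MixedFar n)/relation_eval; rewrite /= !mulg1. Qed.

Lemma sigma_far (j k : 'I_m.+1) : far_apart j k ->
  sigma j * sigma k = sigma k * sigma j.
Proof. by move=> /(@BraidFar n)/relation_eval; rewrite /= !mulg1. Qed.

Lemma sigma_near (j k : 'I_m.+1) : k = j.+1 :> nat ->
  sigma j * sigma k * sigma j = sigma k * sigma j * sigma k.
Proof. by move=> /(@BraidNear n)/relation_eval; rewrite /= !mulg1 -!mulgA. Qed.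

Lemma mixed_near (j k : 'I_m.+1) : k = j.+1 :> nat ->
  rho j * rho k * sigma j = sigma k * rho j * rho k.
Proof. by move=> /(@MixedNear n)/relation_eval; rewrite /= !mulg1 -!mulgA. Qed.

Lemma forbidden_near (j k : 'I_m.+1) : k = j.+1 :> nat ->
  rho j * sigma k * sigma j = sigma k * sigma j * rho k.
Proof. by move=> /(@Forbidden n)/relation_eval; rewrite /= !mulg1 -!mulgA. Qed.

Lemma welded_ind (P : W -> Prop) :
  P 1 -> (forall g k, P g -> P (g * sigma k)) ->
  (forall g k, P g -> P (g * (sigma k)^-1)) ->
  (forall g k, P g -> P (g * rho k)) -> forall g, P g.
Proof.
move=> P1 Ps PV Pr; apply: presented_ind => // g [k|k] Pg; first exact: Ps.
- exact: Pr.
- exact: PV.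
- by rewrite -[presented_gen _ _]/(rho k) rhoV; apply: Pr.
Qed.

Definition lo (k : 'I_m.+1) : 'I_n := widen_ord (leqnSn _) k.
Definition hi (k : 'I_m.+1) : 'I_n := lift ord0 k.
Definition swap (k : 'I_m.+1) : {perm 'I_n} := tperm (lo k) (hi k).

Lemma lo_neq_hi k : lo k != hi k.
Proof. by rewrite -val_eqE /= /bump /=; lia. Qed.

Lemma swapK k : swap k * swap k = 1.
Proof. exact: tperm2. Qed.

Lemma mul_swapK x k : x * swap k * swap k = x.
Proof. by rewrite -mulgA swapK mulg1. Qed.

Lemma val_swap k i : swap k i =
  (if i == k :> nat then k.+1 else if i == k.+1 :> nat then nat_of_ord k else i) :> nat.
Proof.
have valE : (i == lo k) = (i == k :> nat) /\ (i == hi k) = (i == k.+1 :> nat).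
  by rewrite -!val_eqE.
rewrite -valE.1 -valE.2 /swap; case: tpermP => [->|->|/eqP/negPf-> /eqP/negPf->//].
  by rewrite eqxx.
by rewrite eqxx eq_sym (negPf (lo_neq_hi k)).
Qed.

(** This sum replaces the number of inversions: swapping the values k and k+1
    changes it by the difference of their positions, so it decreases exactly at
    the descents of the inverse permutation. *)
Definition disorder (x : {perm 'I_n}) : nat := \sum_(j < n) j * (n - x j).

Lemma disorder_swap x k :
  (disorder (x * swap k) + x^-1 (lo k) = disorder x + x^-1 (hi k))%N.
Proof.
set a := x^-1 (lo k); set b := x^-1 (hi k).
have ba : b != a by rewrite (inj_eq perm_inj) eq_sym lo_neq_hi.
have xa : x a = lo k by rewrite permKV.
have xb : x b = hi k by rewrite permKV.
have split_ab (F : 'I_n -> nat) :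
    \sum_i F i = (F a + (F b + \sum_(i | (i != a) && (i != b)) F i))%N.
  by rewrite (bigD1 a) //= (bigD1 b).
rewrite /disorder !split_ab !permM xa xb /swap tpermL tpermR.
rewrite (eq_bigr (fun j : 'I_n => j * (n - x j))%N) => [|i /andP[ia ib]].
  by rewrite /= /bump /=; have := ltn_ord k; nia.
by rewrite permM tpermD // -?xa -?xb (inj_eq perm_inj) eq_sym.
Qed.

Lemma swap_inv x k i : (x * swap k)^-1 i = x^-1 (swap k i).
Proof. by rewrite invgM permM tpermV. Qed.

Lemma disorder_ltn x k :
  (disorder (x * swap k) < disorder x)%N = (x^-1 (hi k) < x^-1 (lo k))%N.
Proof. by have := disorder_swap x k; lia. Qed.

Lemma disorder_neq x k : disorder (x * swap k) <> disorder x.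
Proof.
have := disorder_swap x k.
have : x^-1 (hi k) != x^-1 (lo k) by rewrite (inj_eq perm_inj) eq_sym lo_neq_hi.
by rewrite -val_eqE /=; lia.
Qed.

Lemma swap_far (j k : 'I_m.+1) : far_apart j k -> swap j * swap k = swap k * swap j.
Proof.
rewrite /far_apart => jk; apply/permP => i; apply: val_inj.
rewrite /= !permM !val_swap; move: (nat_of_ord i) (nat_of_ord j) (nat_of_ord k) jk => a b c.
by split_ifs; lia.
Qed.

Lemma swap_near (j k : 'I_m.+1) : k = j.+1 :> nat ->
  swap j * swap k * swap j = swap k * swap j * swap k.
Proof.
move=> jk; apply/permP => i; apply: val_inj.
rewrite /= !permM !val_swap jk; move: (nat_of_ord i) (nat_of_ord j) => a b.
by split_ifs; lia.
Qed.

Lemma lo_hi_near (j k : 'I_m.+1) : k = j.+1 :> nat -> lo k = hi j.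
Proof. by move=> jk; apply: val_inj; rewrite /= /bump. Qed.

Lemma swap_hi_lo (j k : 'I_m.+1) : k = j.+1 :> nat ->
  [/\ swap j (hi k) = hi k, swap j (lo k) = lo j, swap k (lo j) = lo j
    & swap k (hi j) = hi k].
Proof.
by move=> jk; split; apply: val_inj; rewrite /= !val_swap /= /bump /= jk;
   split_ifs; lia.
Qed.

Lemma swap_out (j k : 'I_m.+1) : far_apart j k ->
  swap j (lo k) = lo k /\ swap j (hi k) = hi k.
Proof.
rewrite /far_apart => jk.
by split; apply: val_inj; rewrite /= !val_swap /= /bump /=; split_ifs; lia.
Qed.

Local Notation rho_word := (@word_value 'I_m.+1 W rho).
Local Notation swap_word := (foldl (fun x k => x * swap k)).

Local Notation swap_act := (fun x k => x * swap k).

(** At two adjacent descents the two sides of the braid relation both lead down,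
    to a common bottom; the bypass goes down one side and up the other. *)
Lemma disorder_peak_near x (c d : 'I_m.+1) :
  d = c.+1 :> nat \/ c = d.+1 :> nat ->
  (disorder (x * swap c) < disorder x)%N ->
  (disorder (x * swap d) < disorder x)%N ->
  exists u, [/\ below swap_act disorder (disorder x) (x * swap c) u,
    swap_word (x * swap c) u = x * swap d & rho c * rho_word u = rho d].
Proof.
move=> cd lc ld; exists [:: d; c; d; c].
have braid : swap c * swap d * swap c = swap d * swap c * swap d.
  by case: cd => cd; [rewrite (swap_near cd) | rewrite (swap_near cd)].
have rbraid : rho c * rho d * rho c = rho d * rho c * rho d.
  by case: cd => cd; [rewrite (rho_near cd) | rewrite (rho_near cd)].
have xcdcd : x * swap c * swap d * swap c * swap d = x * swap d * swap c.
  by rewrite -!(mulgA x) braid -[in LHS]mulgA swapK mulg1.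
have [lt1 lt2 lt3] : [/\ (disorder (x * swap c * swap d) < disorder (x * swap c))%N,
    (disorder (x * swap d * swap c) < disorder (x * swap d))%N
  & (disorder (x * swap c * swap d * swap c) < disorder (x * swap c * swap d))%N].
  move: lc ld; rewrite !disorder_ltn !swap_inv.
  case: cd => cd; have [e1 e2 e3 e4] := swap_hi_lo cd; have e5 := lo_hi_near cd;
    rewrite ?e1 ?e2 ?e3 ?e4 -?e5 ?e1 ?e2 ?e3 ?e4 ?/swap ?tpermL ?tpermR e5 ?tpermL ?tpermR;
    split; lia.
rewrite /= xcdcd mul_swapK; split=> //.
- by repeat split=> //; lia.
- by rewrite mulg1 !mulgA rbraid !mul_rhoK.
Qed.

Lemma disorder_peak_far x (j k : 'I_m.+1) : far_apart j k ->
  (disorder (x * swap j) < disorder x)%N ->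
  (disorder (x * swap k) < disorder x)%N ->
  exists u, [/\ below swap_act disorder (disorder x) (x * swap j) u,
    swap_word (x * swap j) u = x * swap k & rho j * rho_word u = rho k].
Proof.
move=> far xj xk; exists [:: k; j] => /=.
have [e1 e2] := swap_out far.
have xkj : x * swap j * swap k * swap j = x * swap k.
  by rewrite -(mulgA x) (swap_far far) mulgA mul_swapK.
rewrite xkj mulg1 mulgA (rho_far far) mul_rhoK; split=> //.
split=> //; apply: leq_trans xj; rewrite ltnW // ltnS disorder_ltn !swap_inv e1 e2.
by rewrite -disorder_ltn.
Qed.

Lemma disorder_peak x j k : (disorder (x * swap j) < disorder x)%N ->
  (disorder (x * swap k) < disorder x)%N ->
  exists u, [/\ below swap_act disorder (disorder x) (x * swap j) u,
    swap_word (x * swap j) u = x * swap k & rho j * rho_word u = rho k].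
Proof.
move=> xj xk; have [jk|kj|/ord_inj jk] := ltngtP j k.
- have [kj1|kj1] := eqVneq (nat_of_ord k) j.+1.
    by apply: disorder_peak_near => //; left.
  by apply: disorder_peak_far => //; rewrite /far_apart; lia.
- have [kj1|kj1] := eqVneq (nat_of_ord j) k.+1.
    by apply: disorder_peak_near => //; right.
  by apply: disorder_peak_far => //; rewrite /far_apart; lia.
- by exists [::]; rewrite jk /= mulg1.
Qed.

Lemma swap_wordE x u : swap_word x u = x * swap_word 1 u.
Proof.
elim/last_ind: u => [|u k IHu] /=; first by rewrite mulg1.
by rewrite -cats1 !foldl_cat /= IHu mulgA.
Qed.

(** The Coxeter presentation of the symmetric group: permutations are descended
    along their disorder. *)
Lemma rho_word_perm u v : swap_word 1 u = swap_word 1 v -> rho_word u = rho_word v.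
Proof.
apply: (@free_action _ _ swap_act W rho (fun=> True) disorder id) => //.
- by move=> x s _; apply: mul_swapK.
- by move=> s; rewrite rhoV.
- by move=> x s _; apply: disorder_neq.
- by move=> x s t _; apply: disorder_peak.
Qed.

(** A permutation of 0, ..., n-1 without descents is increasing, hence the
    identity. *)
Lemma perm_descent (x : {perm 'I_n}) : x <> 1 ->
  exists k, (disorder (x * swap k) < disorder x)%N.
Proof.
move=> x1; apply: contrapT => nd; apply: x1.
have incr k : (x^-1 (lo k) < x^-1 (hi k))%N.
  have : x^-1 (hi k) != x^-1 (lo k) by rewrite (inj_eq perm_inj) eq_sym lo_neq_hi.
  case: ltngtP => // [lt|/ord_inj->]; last by rewrite eqxx.
  by move=> _; case: nd; exists k; rewrite disorder_ltn.
have above (i : 'I_n) : (i <= x^-1 i)%N.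
  case: i; elim=> [//|i IHi] lt_i; have := incr (Ordinal (lt_i : (i < m.+1)%N)).
  have lt' : (i < n)%N by exact: ltnW.
  have -> : lo (Ordinal (lt_i : (i < m.+1)%N)) = Ordinal lt' by apply: val_inj.
  have -> : hi (Ordinal (lt_i : (i < m.+1)%N)) = Ordinal lt_i by apply: val_inj.
  exact/leq_ltn_trans/IHi.
apply: invg_inj; rewrite invg1; apply/permP => i; rewrite perm1; apply: val_inj.
have [k] := ubnP (n - i)%N; elim: k i => // k IHk i ik.
apply/eqP; rewrite eqn_leq above andbT leqNgt; apply/negP => lt /=.
have fix_above (j : 'I_n) : (i < j)%N -> x^-1 j = j.
  by move=> ij; apply: val_inj; apply: IHk; have := ltn_ord j; lia.
by have /perm_inj fix_i := fix_above _ lt; rewrite fix_i ltnn in lt.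
Qed.

Lemma swap_generate (x : {perm 'I_n}) : exists u, swap_word 1 u = x.
Proof.
have [k] := ubnP (disorder x); elim: k x => // k IHk x xk.
have [->|/perm_descent[j xj]] := pselect (x = 1); first by exists [::].
have [|u ux] := IHk (x * swap j); first exact: leq_trans xj _.
by exists (rcons u j); rewrite -cats1 foldl_cat ux /= mul_swapK.
Qed.

Definition perm_word (x : {perm 'I_n}) : seq 'I_m.+1 := projT1 (cid (swap_generate x)).

Lemma perm_wordK x : swap_word 1 (perm_word x) = x.
Proof. exact: projT2 (cid (swap_generate x)). Qed.

Definition braid_of_perm (x : {perm 'I_n}) : W := rho_word (perm_word x).

Lemma braid_of_perm_word u : braid_of_perm (swap_word 1 u) = rho_word u.
Proof. by apply: rho_word_perm; rewrite perm_wordK. Qed.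

Lemma braid_of_permM : {morph braid_of_perm : x y / x * y}.
Proof.
move=> x y; rewrite -word_value_cat; apply: rho_word_perm.
by rewrite foldl_cat !perm_wordK swap_wordE perm_wordK.
Qed.

HB.instance Definition _ :=
  isMultiplicative.Build {perm 'I_n} W braid_of_perm braid_of_permM.

Lemma braid_of_perm1 : braid_of_perm 1 = 1.
Proof. exact: multiplicative1. Qed.

Lemma braid_of_permV x : braid_of_perm x^-1 = (braid_of_perm x)^-1.
Proof. exact: multiplicativeV. Qed.

Lemma braid_of_swap k : braid_of_perm (swap k) = rho k.
Proof.
by have := braid_of_perm_word [:: k]; rewrite /= mul1g mulg1.
Qed.

Lemma perm_ind_swap (P : {perm 'I_n} -> Prop) :
  P 1 -> (forall x k, P x -> P (x * swap k)) -> forall x, P x.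
Proof.
move=> P1 Ps x; rewrite -(perm_wordK x).
by elim/last_ind: (perm_word x) => //= u k; rewrite -cats1 foldl_cat; apply: Ps.
Qed.

End WeldedBraids.

(** * Pure generators and McCool's relations *)

(** The group on three strands in terms of b = sigma_k, x = rho_j and the
    3-cycle c = rho_k rho_j, where k = j+1. The mixed relation amounts to
    sigma_j = c b c^-1, and the pure generators of the pairs (j,k+1), (k,k+1)
    and (j,k) of positions become x b c, b c x and c b c^-1 x. *)
Section ThreeStrands.
Variables (G : groupType) (b c x : G).
Hypothesis cc : c * c = c^-1.
Hypothesis xx : x * x = 1.
Hypothesis xc : x * c = c^-1 * x.
Hypothesis braid : c * b * c^-1 * b * c * b * c^-1 = b * c * b * c^-1 * b.
Hypothesis forbidden : x * b * c * b = b * c * b * c^-1 * x.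

Let mul_cc y : y * c * c = y * c^-1. Proof. by rewrite -mulgA cc. Qed.
Let mul_cVcV y : y * c^-1 * c^-1 = y * c. Proof. by rewrite -mulgA -invgM cc invgK. Qed.
Let mul_xx y : y * x * x = y. Proof. by rewrite -mulgA xx mulg1. Qed.
Let mul_xc y : y * x * c = y * c^-1 * x. Proof. by rewrite -mulgA xc mulgA. Qed.
Lemma three_strands_same_target : commute (x * b * c) (b * c * x).
Proof. by rewrite /commute !mulgA forbidden mul_xc mul_xx mul_xx mul_cVcV. Qed.

Lemma three_strands_triangle : commute (x * b * c * (b * c * x)) (c * b * c^-1 * x).
Proof.
rewrite /commute !mulgA forbidden !(mul_xc, mul_xx, mulgK, mulgVK).
have := congr1 (fun y => y * c * c) braid; rewrite mulgVK => ->.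
by rewrite mul_cc.
Qed.
End ThreeStrands.

Section PureGenerators.
Variable m : nat.
Local Notation n := m.+2.
Local Notation W := (welded_braid_group n).
Local Notation iota := (@braid_of_perm m).

Definition pos0 : 'I_n := lo ord0.
Definition pos1 : 'I_n := hi ord0.

Definition alpha_perm (i j : 'I_n) : {perm 'I_n} :=
  tperm pos0 i * tperm (tperm pos0 i pos1) j.

Fact alpha_key : unit. Proof. by []. Qed.

(** The pure generator that conjugates the entry at i by the entry at j: move
    these entries to the first two positions, conjugate there, and move back. *)
Definition alpha (i j : 'I_n) : W :=
  locked_with alpha_key ((sigma ord0 * rho ord0) ^ iota (alpha_perm i j)).

Lemma alphaE i j : alpha i j = (sigma ord0 * rho ord0) ^ iota (alpha_perm i j).
Proof. by rewrite /alpha unlock. Qed.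

Lemma alpha_permP i j : i != j -> alpha_perm i j pos0 = i /\ alpha_perm i j pos1 = j.
Proof.
move=> ij; rewrite !permM tpermL; split; last by rewrite tpermL.
rewrite [tperm _ _ i]tpermD // 1?eq_sym //.
by rewrite -{1}(tpermL pos0 i) (inj_eq perm_inj) lo_neq_hi.
Qed.

(** The descents of a permutation that fixes the first two positions lie beyond
    them, so it is a product of swaps that are far from these positions. *)
Lemma commute_iota_stab (x : {perm 'I_n}) : x pos0 = pos0 -> x pos1 = pos1 ->
  commute (sigma ord0 * rho ord0) (iota x).
Proof.
have [k] := ubnP (disorder x); elim: k x => // k IHk x xk x0 x1.
have [->|/perm_descent[j xj]] := pselect (x = 1).
  by rewrite braid_of_perm1; apply: commute1.
have xV0 : x^-1 pos0 = pos0 by rewrite -{1}x0 permK.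
have xV1 : x^-1 pos1 = pos1 by rewrite -{1}x1 permK.
have j1 : (1 < j)%N.
  move: (xj); rewrite disorder_ltn; case: j {xj} => -[|[|j]] lt_j //.
    have -> : hi (Ordinal lt_j) = pos1 by apply: val_inj.
    have -> : lo (Ordinal lt_j) = pos0 by apply: val_inj.
    by rewrite xV0 xV1.
  have -> : lo (Ordinal lt_j) = pos1 by apply: val_inj.
  rewrite xV1 ltnS leqn0 => /eqP h0.
  have : x^-1 (hi (Ordinal lt_j)) = pos0 by apply: val_inj.
  by rewrite -[RHS]xV0 => /perm_inj/(congr1 val).
have s0 : swap j pos0 = pos0 by apply: val_inj; rewrite /= val_swap /=; split_ifs; lia.
have s1 : swap j pos1 = pos1 by apply: val_inj; rewrite /= val_swap /= /bump /=; split_ifs; lia.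
have : commute (sigma ord0 * rho ord0) (iota (x * swap j)).
  by apply: IHk; rewrite ?permM ?x0 ?x1 ?s0 ?s1 //; apply: leq_trans xj _.
have far : far_apart ord0 j by rewrite /far_apart j1.
have cj : commute (sigma ord0 * rho ord0) (rho j).
  by rewrite /commute -mulgA (rho_far far) !mulgA (sigma_rho_far far).
rewrite braid_of_permM braid_of_swap => cxj.
by rewrite -[iota x](mul_rhoK _ j); apply: commuteM.
Qed.

(** The choice of the permutation that brings i and j to the front does not
    matter. *)
Lemma alpha_eq (x : {perm 'I_n}) i j : x pos0 = i -> x pos1 = j ->
  (sigma ord0 * rho ord0) ^ iota x = alpha i j.
Proof.
move=> x0 x1; have ij : i != j by rewrite -x0 -x1 (inj_eq perm_inj) lo_neq_hi.
have [a0 a1] := alpha_permP ij.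
have c := @commute_iota_stab (x * (alpha_perm i j)^-1).
rewrite alphaE -{1}(mulgVK (alpha_perm i j) x) braid_of_permM conjgM.
congr (_ ^ _); apply/conjg_fixP/commgP; apply: c.
  by rewrite permM x0; apply: canLR (permK _) (esym a0).
by rewrite permM x1; apply: canLR (permK _) (esym a1).
Qed.

Lemma alphaJ i j (x : {perm 'I_n}) : i != j -> alpha i j ^ iota x = alpha (x i) (x j).
Proof.
move=> /alpha_permP[a0 a1]; rewrite alphaE -conjgM -braid_of_permM.
by apply: alpha_eq; rewrite permM ?a0 ?a1.
Qed.

(** By the mixed relation, rho_k rho_k+1 conjugates one of these elements into the
    next one. *)
Lemma alpha_adjacent (k : 'I_m.+1) : sigma k * rho k = alpha (lo k) (hi k).
Proof.
case: k; elim=> [|k IHk] lt_k.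
  have -> : Ordinal lt_k = ord0 by apply: val_inj.
  by rewrite -(alpha_eq (x := 1)) ?perm1 // braid_of_perm1 conjg1.
have lt_k' : (k < m.+1)%N by exact: ltnW.
have near : Ordinal lt_k = (Ordinal lt_k').+1 :> nat by [].
have [e1 e2 e3 e4] := swap_hi_lo near; have e5 := lo_hi_near near.
set j := Ordinal lt_k' in near e1 e2 e3 e4 e5 *.
set k1 := Ordinal lt_k in near e1 e2 e3 e4 e5 *.
have xlo : (swap k1 * swap j) (lo j) = lo k1 by rewrite permM e3 e5 tpermL.
have xhi : (swap k1 * swap j) (hi j) = hi k1 by rewrite permM e4 e1.
rewrite -xlo -xhi -alphaJ ?lo_neq_hi //.
rewrite -IHk braid_of_permM !braid_of_swap /conjg invgM !rhoV.
by rewrite !mulgA (mixed_near near) (mul_rho_near _ near) !mul_rhoK.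
Qed.

Lemma adjacent_triangle (j k : 'I_m.+1) : k = j.+1 :> nat ->
  let p := lo j in let q := hi j in let r := hi k in
  commute (alpha p r) (alpha q r) /\ commute (alpha p r * alpha q r) (alpha p q).
Proof.
move=> jk p q r; have [e1 e2 e3 e4] := swap_hi_lo jk; have e5 := lo_hi_near jk.
have [c cE] : exists c, c = rho k * rho j by exists (rho k * rho j).
have cV : c^-1 = rho j * rho k by rewrite cE invgM !rhoV.
have cc : c * c = c^-1 by rewrite cV cE mulgA -(rho_near jk) mul_rhoK.
have xc : rho j * c = c^-1 * rho j by rewrite cV cE mulgA.
have rk : rho k = c * rho j by rewrite cE mul_rhoK.
have sj : sigma j = c * sigma k * c^-1.
  by rewrite cV -mulgA (mulgA (sigma k)) -(mixed_near jk) cE !mulgA mul_rhoK rhoK mul1g.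
have aqr : alpha q r = sigma k * c * rho j.
  by rewrite /q -e5 -alpha_adjacent rk mulgA.
have apr : alpha p r = rho j * sigma k * c.
  have := alphaJ (swap j) (lo_neq_hi k).
  rewrite braid_of_swap -alpha_adjacent e1 e2 => <-.
  by rewrite /conjg rhoV cE !mulgA.
have apq : alpha p q = c * sigma k * c^-1 * rho j by rewrite -alpha_adjacent sj.
have braid : c * sigma k * c^-1 * sigma k * c * sigma k * c^-1 =
    sigma k * c * sigma k * c^-1 * sigma k.
  by have := sigma_near jk; rewrite sj !mulgA.
have forb : rho j * sigma k * c * sigma k = sigma k * c * sigma k * c^-1 * rho j.
  have := congr1 (fun y => y * c) (forbidden_near jk).
  rewrite sj rk !mulgA !mulgVK => ->.
  by rewrite -(mulgA _ (rho j) c) xc mulgA.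
rewrite aqr apr apq; split.
  exact: (three_strands_same_target cc (rhoK j) xc forb).
exact: (three_strands_triangle cc (rhoK j) xc braid forb).
Qed.

Lemma three_positions (i j l : 'I_n) : i != j -> i != l -> j != l ->
  exists (a b : 'I_m.+1) (x : {perm 'I_n}),
  [/\ b = a.+1 :> nat, x (lo a) = i, x (hi a) = j & x (hi b) = l].
Proof.
move=> ij il jl.
have u2 : uniq [:: i; j; l] by rewrite /= !inE negb_or ij il jl.
have m0 : (2 < n)%N.
  by move/card_uniqP: (u2) => /= <-; rewrite -[X in (_ <= X)%N](card_ord n) max_card.
pose a : 'I_m.+1 := ord0; pose b : 'I_m.+1 := Ordinal (m0 : (1 < m.+1)%N).
have u1 : uniq [:: lo a; hi a; hi b] by [].
have [x [xi xj xl]] := perm_extension u1 u2 erefl.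
by exists a, b, x.
Qed.

(** McCool's relations, transported by a permutation from adjacent positions. *)
Lemma alpha_triangle_relations i j l : i != j -> i != l -> j != l ->
  commute (alpha i l) (alpha j l) /\ commute (alpha i l * alpha j l) (alpha i j).
Proof.
move=> ij il jl; have [a [b [x [ab xi xj xl]]]] := three_positions ij il jl.
have ac : lo a != hi b by rewrite -(inj_eq (@perm_inj _ x)) xi xl.
have bc : hi a != hi b by rewrite -(inj_eq (@perm_inj _ x)) xj xl.
have [H1 H2] := adjacent_triangle ab; have ne := lo_neq_hi a.
have := congr1 (conjg^~ (iota x)) H1; have := congr1 (conjg^~ (iota x)) H2.
by rewrite /= !conjMg !alphaJ // xi xj xl.
Qed.

Lemma alpha_same_target i j l : i != j -> i != l -> j != l ->
  commute (alpha i l) (alpha j l).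
Proof. by move=> ij il jl; have [] := alpha_triangle_relations ij il jl. Qed.

Lemma alpha_triangle i j l : i != j -> i != l -> j != l ->
  commute (alpha i l * alpha j l) (alpha i j).
Proof. by move=> ij il jl; have [] := alpha_triangle_relations ij il jl. Qed.

Lemma alpha_far i j k l : uniq [:: i; j; k; l] -> commute (alpha i j) (alpha k l).
Proof.
move=> u; have n4 : (4 <= n)%N.
  by move/card_uniqP: (u) => /= <-; rewrite -[X in (_ <= X)%N](card_ord n) max_card.
pose b : 'I_m.+1 := Ordinal (n4 : (2 < m.+1)%N).
have far : far_apart ord0 b by [].
have u1 : uniq [:: pos0; pos1; lo b; hi b] by [].
have [x [x0 x1 xk xl]] := perm_extension u1 u erefl.
have ne := lo_neq_hi b; have ne0 : pos0 != pos1 := lo_neq_hi _.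
have H : commute (alpha pos0 pos1) (alpha (lo b) (hi b)).
  rewrite -!alpha_adjacent; apply: commuteM; apply: commute_sym; apply: commuteM.
  - by rewrite /commute (sigma_far far).
  - by rewrite /commute -(sigma_rho_far _).
  - by rewrite /commute -(sigma_rho_far far).
  - by rewrite /commute (rho_far far).
have := congr1 (conjg^~ (iota x)) H.
by rewrite /= !conjMg !alphaJ // x0 x1 xk xl.
Qed.

End PureGenerators.

(** * Cosets of a cyclic factor of a free group *)

Section CosetWords.
Variable N : nat.
Local Notation X := 'I_N.
Implicit Types (k i j : X) (a b : X * bool) (w v t : word X).

(** The free group acts on the right on the right cosets of the cyclic subgroup
    generated by the letter k. A coset is represented by the reduced word that
    does not begin with k; it is stored with its last letter first. The empty
    word absorbs the letter k. *)
Definition step k w a : word X :=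
  match w with
  | [::] => if a.1 == k then [::] else [:: a]
  | b :: w' => if b == inv_letter a then w' else a :: w
  end.

Definition run k : word X -> word X -> word X := foldl (step k).

Fixpoint reduced k w : bool :=
  if w is a :: w' then reduced k w' && (step k w' a == a :: w') else true.

(** The conjugate v^-1 j v of the letter j, or its inverse: the stabiliser of the
    coset v is generated by it. *)
Definition loop j v (e : bool) : word X :=
  map (@inv_letter X) v ++ (j, e) :: rev v.

Lemma inv_letter_inv a : inv_letter (inv_letter a) = a.
Proof. by case: a => x b; rewrite /inv_letter negbK. Qed.

Lemma step_reduced k w a : reduced k w -> reduced k (step k w a).
Proof.
case: w => [|b w] /=; first by case: ifP => //= ->; rewrite eqxx.
by case: ifP => [_ /andP[]//|/= -> /= ->]; rewrite eqxx.
Qed.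

Lemma run_reduced k w u : reduced k w -> reduced k (run k w u).
Proof. by elim: u w => //= a u IHu w /(step_reduced a)/IHu. Qed.

Lemma stepK k w a : reduced k w -> step k (step k w a) (inv_letter a) = w.
Proof.
case: w => [|b w] /=.
  by case: ifP => /= ak _; rewrite ?ak // inv_letter_inv eqxx.
case: (b =P inv_letter a) => [->|_ _] /=; last by rewrite inv_letter_inv eqxx.
by case/andP=> _ /eqP.
Qed.

Lemma stepKV k w a : reduced k w -> step k (step k w (inv_letter a)) a = w.
Proof. by move=> nw; rewrite -[X in step k _ X]inv_letter_inv stepK. Qed.

Lemma run_cat k w u v : run k w (u ++ v) = run k (run k w u) v.
Proof. exact: foldl_cat. Qed.

Lemma run_inv k w u : reduced k w -> run k (run k w u) (inv_word u) = w.
Proof.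
elim: u w => //= a u IHu w nw.
rewrite /inv_word /= rev_cons -cats1 run_cat IHu ?step_reduced //=.
exact: stepK.
Qed.

Lemma inv_loop j v e : inv_word (loop j v e) = loop j v (~~ e).
Proof.
rewrite /inv_word /loop map_cat rev_cat /= rev_cons cat_rcons.
by rewrite map_rev revK mapK //; apply: inv_letter_inv.
Qed.

Lemma run_loopK k w j v e : reduced k w ->
  run k (run k w (loop j v e)) (loop j v (~~ e)) = w.
Proof. by move=> nw; rewrite -inv_loop run_inv. Qed.

Lemma run_prefix k v t : run k (v ++ t) (map (@inv_letter X) v) = t.
Proof. by elim: v => //= a v IHv; rewrite inv_letter_inv eqxx. Qed.

Lemma run_rev k w v : reduced k w ->
  run k (run k w (map (@inv_letter X) v)) (rev v) = w.
Proof.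
move=> nw; have -> : rev v = inv_word (map (@inv_letter X) v).
  by rewrite /inv_word mapK //; apply: inv_letter_inv.
exact: run_inv.
Qed.

Lemma reduced_cat k u v : reduced k (u ++ v) -> reduced k v.
Proof. by elim: u => //= a u IHu /andP[/IHu]. Qed.

Lemma run_loop_cancel i j v e t :
  run i (v ++ (j, ~~ e) :: t) (loop j v e) = run i t (rev v).
Proof. by rewrite /loop run_cat run_prefix /= /inv_letter /= eqxx. Qed.

Lemma run_rev_loop k p j v e t : reduced k p ->
  run k (run k p (rev (v ++ (j, ~~ e) :: t))) (loop j v e) =
  run k (run k p (rev t)) (rev v).
Proof.
move=> np; have nt := run_reduced (rev t) np.
rewrite rev_cat rev_cons cat_rcons run_cat /loop.
rewrite (run_cat _ _ (map _ _)) /=.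
have -> : map (@inv_letter X) v = inv_word (rev v).
  by rewrite /inv_word map_rev revK.
rewrite run_inv ?step_reduced //.
have -> : (j, e) = inv_letter (j, ~~ e) by rewrite /inv_letter negbK.
by rewrite stepK.
Qed.

Lemma size_step k w a : (size w <= (size (step k w a)).+1 <= (size w).+2)%N.
Proof. by case: w => [|b w] /=; case: ifP => //=; lia. Qed.

Lemma size_run_ge k w u : (size w <= size (run k w u) + size u)%N.
Proof.
elim: u w => [|a u IHu] w /=; first by rewrite addn0.
by have := size_step k w a; have := IHu (step k w a); lia.
Qed.

Lemma size_run_le k w u : (size (run k w u) <= size w + size u)%N.
Proof.
elim: u w => [|a u IHu] w /=; first by rewrite addn0.
by have := size_step k w a; have := IHu (step k w a); lia.
Qed.

(** The first letter of the coset word v, which is stored last, differs from j;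
    hence nothing cancels. *)
Lemma run_push i j v e t : reduced j v ->
  run i ((j, e) :: t) (rev v) = v ++ (j, e) :: t.
Proof.
elim: v => //= a v IHv /andP[nv]; rewrite rev_cons -cats1 run_cat IHv //=.
case: v {IHv nv} => [|b v] /=.
  by case: ifP => // aj _; case: eqP => // /(congr1 fst) /= ja; rewrite -ja eqxx in aj.
by case: ifP => // _ /eqP /(congr1 size) /=; lia.
Qed.

(** After undoing v, the letter j either cancels against its inverse, and then w
    ran along the loop of j and gets shorter, or it is added, and then all of v
    is added after it, which outweighs what has been cancelled before. In
    particular the length never stays the same. *)
Lemma run_loop_cases i j w v e : i != j -> reduced i w -> reduced j v ->
  (exists t, w = v ++ (j, ~~ e) :: t /\ run i w (loop j v e) = run i t (rev v)) \/
  (size w < size (run i w (loop j v e)))%N.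
Proof.
move=> ij nw nv; rewrite /loop run_cat /=.
set Z := run i w _; have wZ : run i Z (rev v) = w by apply: run_rev.
have sZ : (size w <= size Z + size v)%N.
  by rewrite -(size_map (@inv_letter X) v); apply: size_run_ge.
have push : step i Z (j, e) = (j, e) :: Z ->
    (size w < size (run i (step i Z (j, e)) (rev v)))%N.
  by move=> ->; rewrite run_push // size_cat /=; lia.
case: Z wZ sZ push => [|b Z] wZ sZ push; first by right; rewrite push //= eq_sym (negPf ij).
have [bj|bj] := boolP (b == inv_letter (j, e)); last by right; rewrite push //= (negPf bj).
left; exists Z; rewrite /= bj; split=> //.
by rewrite -wZ (eqP bj) run_push.
Qed.

(** This is (v a)^-1 j (v a) = a^-1 (v^-1 j v) a. If the letter a is absorbed by
    the empty word v, it is a power of j and commutes with j. *)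
Lemma run_loop_step i z j v e a : reduced i z ->
  run i z (loop j (step j v a) e) =
  step i (run i (step i z (inv_letter a)) (loop j v e)) a.
Proof.
have push z' c w : run i z' (loop j (c :: w) e) =
    step i (run i (step i z' (inv_letter c)) (loop j w e)) c.
  by rewrite /loop /= rev_cons -rcons_cons -rcons_cat -cats1 run_cat.
move=> nz; case: v => [|b v]; rewrite [step j _ a]/=; last first.
  case: eqP => [->|_]; last exact: push.
  by rewrite push inv_letter_inv !stepKV // run_reduced // stepKV.
case: eqP => [<-|_]; last exact: push.
case: a {push} => x b /=; have [<-|] := eqVneq b e; first by rewrite stepKV.
move=> be; have -> : (x, e) = inv_letter (x, b) by rewrite /inv_letter; case: b e be => [] [].
by rewrite stepKV // step_reduced.
Qed.

Lemma run_loop_run i z j v e u : reduced i z ->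
  run i z (loop j (run j v u) e) = run i (run i (run i z (inv_word u)) (loop j v e)) u.
Proof.
elim/last_ind: u z => [|u a IHu] z nz //=.
have -> : inv_word (rcons u a) = inv_letter a :: inv_word u.
  by rewrite /inv_word map_rcons rev_rcons.
rewrite -cats1 !(run_cat _ _ u [:: a]) -[run j (run j v u) _]/(step j (run j v u) a).
by rewrite run_loop_step // IHu // step_reduced.
Qed.

End CosetWords.

(** * Tuples of conjugates *)

Section Tuples.
Variable m : nat.
Local Notation n := m.+2.
Local Notation W := (welded_braid_group n).
Local Notation words := (word 'I_n).
Implicit Types (w : 'I_n -> words) (i j k l : 'I_n).

Definition update w i z : 'I_n -> words := fun k => if k == i then z else w k.

(** A tuple w of coset words stands for the tuple y of conjugates
    y_i = w_i^-1 x_i w_i of the free generators. Conjugating y_i by y_j amounts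
    to moving the coset w_i along the loop of j at w_j. *)
Definition conj_by w i j e := update w i (run i (w i) (loop j (w j) e)).

Definition reduced_tuple w := forall i, reduced i (w i).

Definition total_size w : nat := \sum_i size (w i).

Lemma updateE w i z : update w i z i = z.
Proof. by rewrite /update eqxx. Qed.

Lemma update_neq w i z k : k != i -> update w i z k = w k.
Proof. by rewrite /update => /negPf->. Qed.

Lemma conj_by_neq w i j e k : k != i -> conj_by w i j e k = w k.
Proof. exact: update_neq. Qed.

Lemma conj_byE w i j e : conj_by w i j e i = run i (w i) (loop j (w j) e).
Proof. exact: updateE. Qed.

Lemma total_size_update w i z :
  (total_size (update w i z) + size (w i) = total_size w + size z)%N.
Proof.
have split F : (\sum_j F j = F i + \sum_(j | j != i) F j)%N by rewrite (bigD1 i).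
rewrite /total_size !split updateE.
rewrite (eq_bigr (fun k => size (w k))) => [|k ki].
  by rewrite -addnA addnC (addnC (\sum_(j | _) _)%N).
by rewrite update_neq.
Qed.

Lemma conj_by_reduced w i j e : reduced_tuple w -> reduced_tuple (conj_by w i j e).
Proof.
move=> nw k; rewrite /conj_by /update; case: eqP => [->|_]; last exact: nw.
exact/run_reduced.
Qed.

Lemma conj_byK w i j e : i != j -> reduced_tuple w ->
  conj_by (conj_by w i j e) i j (~~ e) = w.
Proof.
move=> ij nw; apply/funext => k; have [->|ki] := eqVneq k i.
  by rewrite !conj_byE conj_by_neq 1?eq_sym // run_loopK.
by rewrite !conj_by_neq.
Qed.

Lemma conj_by_comm w i j k l e d : i != k -> j != k -> l != i ->
  conj_by (conj_by w i j e) k l d = conj_by (conj_by w k l d) i j e.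
Proof.
move=> ik jk li; apply/funext => p; rewrite /conj_by /update.
rewrite [k == i]eq_sym (negPf ik) (negPf jk) (negPf li).
by have [->|pk] := eqVneq p k; rewrite // eq_sym (negPf ik).
Qed.

(** Conjugation by y_l is an automorphism, so y_i may be conjugated by y_j before
    it is applied to both, or by the new y_j afterwards. *)
Lemma conj_by_triangle w i j l e d : i != j -> i != l -> j != l -> reduced_tuple w ->
  conj_by (conj_by (conj_by w i j e) j l d) i l d =
  conj_by (conj_by (conj_by w i l d) j l d) i j e.
Proof.
move=> ij il jl nw; apply/funext => p.
have [li lj ji] : [/\ l != i, l != j & j != i] by rewrite ![l == _]eq_sym [j == i]eq_sym.
have [->|pi] := eqVneq p i.
  rewrite !(conj_byE, conj_by_neq _ _ _ ij, conj_by_neq _ _ _ il, conj_by_neq _ _ _ jl).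
  rewrite !(conj_by_neq _ _ _ ji, conj_by_neq _ _ _ li, conj_by_neq _ _ _ lj).
  by rewrite run_loop_run ?run_inv //; apply/run_reduced.
have [->|pj] := eqVneq p j; last by rewrite !conj_by_neq.
by rewrite !(conj_byE, conj_by_neq _ _ _ ij, conj_by_neq _ _ _ il, conj_by_neq _ _ _ jl,
  conj_by_neq _ _ _ ji, conj_by_neq _ _ _ li, conj_by_neq _ _ _ lj).
Qed.

Lemma conj_by_reduces w i j e : i != j -> reduced_tuple w ->
  (total_size (conj_by w i j e) < total_size w)%N ->
  exists t, w i = w j ++ (j, ~~ e) :: t /\
    run i (w i) (loop j (w j) e) = run i t (rev (w j)).
Proof.
move=> ij nw; have := total_size_update w i (run i (w i) (loop j (w j) e)).
rewrite -/(conj_by w i j e).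
have [[t [? ?]] _ _|] := run_loop_cases e ij (nw i) (nw j); first by exists t.
by move=> *; exfalso; lia.
Qed.

Lemma reduces_conj_by w i j e t : i != j -> reduced_tuple w ->
  w i = w j ++ (j, ~~ e) :: t ->
  (total_size (conj_by w i j e) < total_size w)%N.
Proof.
move=> ij nw wi; have := total_size_update w i (run i (w i) (loop j (w j) e)).
rewrite -/(conj_by w i j e).
have -> : run i (w i) (loop j (w j) e) = run i t (rev (w j)).
  by rewrite wi run_loop_cancel.
have := size_run_le i t (rev (w j)); rewrite wi !size_cat size_rev /=; lia.
Qed.

Lemma total_size_neq w i j e : i != j -> reduced_tuple w ->
  total_size (conj_by w i j e) <> total_size w.
Proof.
move=> ij nw; have := total_size_update w i (run i (w i) (loop j (w j) e)).
rewrite -/(conj_by w i j e).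
have [[t [wi ->]]|] := run_loop_cases e ij (nw i) (nw j); last lia.
have := size_run_le i t (rev (w j)); rewrite wi !size_cat size_rev /=; lia.
Qed.

Definition pure_move : Type := {p : 'I_n * 'I_n | p.1 != p.2} * bool.

Definition move (s : pure_move) w := conj_by w (val s.1).1 (val s.1).2 s.2.
Definition inverse_move (s : pure_move) : pure_move := (s.1, ~~ s.2).
Definition alpha_sign i j (e : bool) : W := if e then (alpha i j)^-1 else alpha i j.
Definition pure_value (s : pure_move) : W := alpha_sign (val s.1).1 (val s.1).2 s.2.
Definition pmove i j (ij : i != j) e : pure_move :=
  (exist (fun p : 'I_n * 'I_n => p.1 != p.2) (i, j) ij, e).

Local Notation act := (fun w s => move s w).
Local Notation bypassed := (@bypass _ _ act W pure_value total_size).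

Lemma alpha_signV i j e : alpha_sign i j (~~ e) = (alpha_sign i j e)^-1.
Proof. by case: e; rewrite /= ?invgK. Qed.

Lemma commute_sign (G : groupType) (x y : G) (e d : bool) : commute x y ->
  commute (if e then x^-1 else x) (if d then y^-1 else y).
Proof.
move=> xy; case: e; last by case: d => //; apply: commuteV.
by apply: commute_sym; apply: commuteV; apply: commute_sym; case: d => //; apply: commuteV.
Qed.

Lemma alpha_sign_triangle i j l e d : i != j -> i != l -> j != l ->
  alpha_sign i j e * alpha_sign j l d * alpha_sign i l d =
  alpha_sign i l d * alpha_sign j l d * alpha_sign i j e.
Proof.
move=> ij il jl; have c1 := alpha_same_target ij il jl.
have c2 := @commute_sign _ _ _ d e (alpha_triangle ij il jl).
have c3 : alpha_sign i l d * alpha_sign j l d = alpha_sign j l d * alpha_sign i l d.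
  exact: commute_sign.
rewrite -mulgA -c3; apply: esym.
have -> : alpha_sign i l d * alpha_sign j l d =
    if d then (alpha i l * alpha j l)^-1 else alpha i l * alpha j l.
  by rewrite c3 /alpha_sign; case: d {c2 c3} => //; rewrite ?invgM.
exact: c2.
Qed.

(** The word w_i runs along the loops of j and of l, so y_l shortens y_i too. The
    moves of the triangle relation shorten in both orders; when y_i is conjugated
    by y_j first, its conjugation by y_l may lengthen it again, but not beyond
    its initial length. *)
Lemma bypass_triangle w i j l e d t1 t2 (ij : i != j) (il : i != l) (jl : j != l) :
  reduced_tuple w -> w i = w j ++ (j, ~~ e) :: t1 -> w j = w l ++ (l, ~~ d) :: t2 ->
  bypassed w (pmove ij e) (pmove il d) /\ bypassed w (pmove ij e) (pmove jl d).
Proof.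
move=> nw wi wj; set w1 := conj_by w i j e; set w2 := conj_by w1 j l d.
set w3 := conj_by w2 i l d; set v := conj_by (conj_by w i l d) j l d.
have wil : w i = w l ++ (l, ~~ d) :: (t2 ++ (j, ~~ e) :: t1).
  by rewrite wi wj -catA.
have [li lj ji] : [/\ l != i, l != j & j != i] by rewrite ![l == _]eq_sym [j == i]eq_sym.
have nw1 : reduced_tuple w1 by apply: conj_by_reduced.
have nw2 : reduced_tuple w2 by apply: conj_by_reduced.
have lt1 : (total_size w1 < total_size w)%N by apply: reduces_conj_by wi.
have lt2 : (total_size w2 < total_size w)%N.
  apply: leq_trans lt1; rewrite ltnW // ltnS.
  by apply: (@reduces_conj_by w1 j l d t2) => //; rewrite /w1 !conj_by_neq.
have lil : (total_size (conj_by w i l d) < total_size w)%N by apply: reduces_conj_by wil.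
have lv : (total_size v < total_size w)%N.
  apply: leq_trans lil; rewrite ltnW // ltnS.
  by apply: (@reduces_conj_by _ j l d t2) => //; [apply: conj_by_reduced | rewrite !conj_by_neq].
have lt3 : (total_size w3 < total_size w)%N.
  have nt1 : reduced i t1.
    by have := nw i; rewrite wi => /reduced_cat /andP[].
  have w3i : w3 i = run i (run i t1 (rev t2)) (rev (w l)).
    rewrite [w3 i]conj_byE [w2 i]conj_by_neq // [w1 i]conj_byE wi run_loop_cancel.
    by rewrite [w2 l]conj_by_neq // [w1 l]conj_by_neq // wj run_rev_loop.
  have w2j : w2 j = run j t2 (rev (w l)).
    by rewrite [w2 j]conj_byE [w1 j]conj_by_neq // [w1 l]conj_by_neq // wj run_loop_cancel.
  have := total_size_update w i (w1 i); have := total_size_update w1 j (w2 j).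
  have := total_size_update w2 i (w3 i).
  have -> : update w2 i (w3 i) = w3 by rewrite [w3 i]conj_byE.
  have -> : update w1 j (w2 j) = w2 by rewrite [w2 j]conj_byE.
  have -> : update w i (w1 i) = w1 by rewrite [w1 i]conj_byE.
  have -> : w2 i = w1 i by rewrite [w2 i]conj_by_neq.
  have -> : w1 j = w j by rewrite [w1 j]conj_by_neq.
  have := size_run_le i (run i t1 (rev t2)) (rev (w l)).
  have := size_run_le i t1 (rev t2); have := size_run_le j t2 (rev (w l)).
  by rewrite -w3i -w2j !size_rev wi wj !size_cat /=; lia.
have tri : w3 = conj_by v i j e by apply: conj_by_triangle.
have vE : v = conj_by (conj_by w j l d) i l d by apply: conj_by_comm => //; rewrite eq_sym.
have c3 : alpha_sign i l d * alpha_sign j l d = alpha_sign j l d * alpha_sign i l d.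
  exact/commute_sign/alpha_same_target.
have w3v : conj_by w3 i j (~~ e) = v by rewrite tri conj_byK //; do 2 apply: conj_by_reduced.
(* Both paths go down to w3 and return along the other side of the relation. *)
split.
- exists [:: pmove jl d; pmove il d; pmove ij (~~ e); pmove jl (~~ d)].
  rewrite /= /move /= -/w1 -/w2 -/w3 w3v conj_byK //; last exact: conj_by_reduced.
  split=> //; rewrite /pure_value /= !alpha_signV mulg1 !mulgA alpha_sign_triangle //.
  by rewrite !mulgK.
- exists [:: pmove jl d; pmove il d; pmove ij (~~ e); pmove il (~~ d)].
  have back : conj_by v i l (~~ d) = conj_by w j l d.
    by rewrite vE conj_byK //; apply: conj_by_reduced.
  have ljl : (total_size (conj_by w j l d) < total_size w)%N by apply: reduces_conj_by wj.
  rewrite /= /move /= -/w1 -/w2 -/w3 w3v back; split=> //.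
  rewrite /pure_value /= !alpha_signV mulg1 !mulgA alpha_sign_triangle // c3.
  by rewrite !mulgK.
Qed.

Lemma bypass_commute w i j k l e d (ij : i != j) (kl : k != l) :
  i != k -> j != k -> l != i -> reduced_tuple w ->
  commute (alpha i j) (alpha k l) ->
  (total_size (conj_by w i j e) < total_size w)%N ->
  (total_size (conj_by w k l d) < total_size w)%N ->
  bypassed w (pmove ij e) (pmove kl d).
Proof.
move=> ik jk li nw c lt1 lt2.
have [t [wk _]] := conj_by_reduces kl nw lt2.
have nw1 := conj_by_reduced i j e nw; have nw2 := conj_by_reduced k l d nw.
have back : conj_by (conj_by (conj_by w i j e) k l d) i j (~~ e) = conj_by w k l d.
  have -> : conj_by (conj_by w i j e) k l d = conj_by (conj_by w k l d) i j e.
    exact: conj_by_comm.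
  by rewrite conj_byK.
exists [:: pmove kl d; pmove ij (~~ e)]; rewrite /= /move /= back.
have cs : alpha_sign i j e * alpha_sign k l d = alpha_sign k l d * alpha_sign i j e.
  exact: commute_sign.
split=> //; last first.
  by rewrite /pure_value /= !alpha_signV mulg1 !mulgA cs mulgK.
split=> //; apply: leq_trans lt1; rewrite ltnW // ltnS.
apply: (@reduces_conj_by _ k l d t) => //.
by rewrite !conj_by_neq // eq_sym.
Qed.

(** If both moves shorten the same w_i, the conjugating words are suffixes of
    w_i, hence nested, and the moves are equal or sides of a triangle. The same holds
    if one move changes the loop that the other one uses. Otherwise the moves
    commute. *)
Lemma pure_peak w s t : reduced_tuple w ->
  (total_size (move s w) < total_size w)%N ->
  (total_size (move t w) < total_size w)%N -> bypassed w s t.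
Proof.
case: s t => [[[i j] /= ij] e] [[[k l] /= kl] d] nw lt1 lt2.
rewrite -[(exist _ _ _, e)]/(pmove ij e) -[(exist _ _ _, d)]/(pmove kl d).
have sym x y : (total_size (move y w) < total_size w)%N -> bypassed w y x -> bypassed w x y.
  apply: (@bypass_sym _ _ act W pure_value reduced_tuple total_size inverse_move) nw => //.
  - by move=> w' s nw'; apply: conj_by_reduced.
  - by move=> w' [[[a b] /= ab] f] nw'; apply: conj_byK.
  - by move=> [[[a b] /= ab] f]; apply: alpha_signV.
have [t1 [wi _]] := conj_by_reduces ij nw lt1.
have [t2 [wk _]] := conj_by_reduces kl nw lt2.
have [ik|ik] := eqVneq i k.
  subst k; move: wk; rewrite {1}wi => wk.
  have nested (a b : 'I_n) (f g : bool) r1 r2 : (size (w b) < size (w a))%N ->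
      w a ++ (a, ~~ f) :: r1 = w b ++ (b, ~~ g) :: r2 ->
      exists r, w a = w b ++ (b, ~~ g) :: r.
    move=> lt E; exists (drop (size (w b)).+1 (w a)).
    rewrite -{1}(cat_take_drop (size (w b)) (w a)) (drop_nth (b, g)) //.
    have := congr1 (take (size (w b))) E; rewrite takel_cat ?(ltnW lt) // take_size_cat // => ->.
    have := congr1 (fun r => nth (b, g) r (size (w b))) E.
    by rewrite nth_cat lt nth_cat ltnn subnn /= => ->.
  have [lt|gt|eq] := ltngtP (size (w j)) (size (w l)).
  - have [r wl] := nested l j d e t2 t1 lt (esym wk).
    have jl : l != j by apply: contraTneq lt => ->; rewrite ltnn.
    by apply: sym => //; have [] := bypass_triangle kl ij jl nw (etrans wi wk) wl.
  - have [r wj] := nested j l e d t1 t2 gt wk.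
    have jl : j != l by apply: contraTneq gt => ->; rewrite ltnn.
    by have [] := bypass_triangle ij kl jl nw wi wj.
  - have := congr1 (fun r => nth (j, e) r (size (w j))) wk.
    rewrite nth_cat ltnn subnn eq nth_cat ltnn subnn /= => -[jl] /negb_inj ed.
    subst l d; rewrite (bool_irrelevance kl ij); exists [::]; split=> //.
    by rewrite mulg1.
have [jk|jk] := eqVneq j k.
  subst k; have il : i != l.
    apply/eqP => il; subst l; have := congr1 size wi; rewrite wk !size_cat /=; lia.
  by have [] := bypass_triangle ij il kl nw wi wk.
have [li|li] := eqVneq l i.
  subst l; have kj : k != j by rewrite eq_sym.
  by apply: sym => //; have [] := bypass_triangle kl kj ij nw wk wi.
apply: bypass_commute => //.
have [jl|jl] := eqVneq j l; first by subst l; apply: alpha_same_target.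
by apply: alpha_far; rewrite /= !inE !negb_or ij ik jk jl kl ![i == l]eq_sym li.
Qed.

Theorem pure_faithful w u : reduced_tuple w -> foldl (fun w s => move s w) w u = w ->
  word_value pure_value u = 1.
Proof.
move=> nw uw; apply: (@free_action _ _ act W pure_value reduced_tuple total_size
  inverse_move) (u) [::] nw uw => //.
- by move=> w' s nw'; apply: conj_by_reduced.
- by move=> w' [[[a b] /= ab] f] nw'; apply: conj_byK.
- by move=> [[[a b] /= ab] f]; apply: alpha_signV.
- by move=> w' [[[a b] /= ab] f] nw'; apply: total_size_neq.
- exact: pure_peak.
Qed.

End Tuples.

(** * Residual finiteness *)

(** A letter acts on a finite set of cosets by a partial injection, which extends
    to a permutation of this set. *)
Lemma eval_letter_perm (N : nat) (k : 'I_N) (L : seq (word 'I_N)) :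
  (forall w, w \in L -> reduced k w) ->
  exists e : 'I_N -> {perm seq_sub L}, forall a (p : seq_sub L),
    step k (val p) a \in L -> val (eval_letter e a p) = step k (val p) a.
Proof.
move=> nL.
have {}nL (p : seq_sub L) : reduced k (val p) by apply/nL/valP.
have ext (x : 'I_N) : exists s : {perm seq_sub L}, forall p : seq_sub L,
    step k (val p) (x, false) \in L -> val (s p) = step k (val p) (x, false).
  pose S := [seq p <- enum {: seq_sub L} | step k (val p) (x, false) \in L].
  pose f (p : seq_sub L) : seq_sub L := insubd p (step k (val p) (x, false)).
  have fE p : p \in S -> val (f p) = step k (val p) (x, false).
    by rewrite mem_filter val_insubd => /andP[->].
  have inj_f : {in S &, injective f}.
    move=> p q pS qS /(congr1 val); rewrite !fE // => pq; apply: val_inj.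
    by rewrite -(stepK (x, false) (nL p)) pq stepK.
  have uS : uniq S by rewrite filter_uniq ?enum_uniq.
  have uf : uniq (map f S) by rewrite map_inj_in_uniq.
  have [s sf] := perm_extension uS uf (esym (size_map f S)).
  exists s => p pL; have pS : p \in S by rewrite mem_filter pL mem_enum.
  by move/eq_in_map: sf => /(_ p pS) ->; apply: fE.
have [e eP] := choice ext; exists e => -[x []] p pL; last exact: eP.
rewrite /eval_letter /=; pose q : seq_sub L := SeqSub pL.
have qp : step k (val q) (x, false) = val p.
  by rewrite -[RHS](stepK (x, true) (nL p)).
suff exq : e x q = p by rewrite -{1}exq permK.
have qpL : step k (val q) (x, false) \in L by rewrite qp; apply: valP.
by apply: val_inj; rewrite (eP x q qpL).
Qed.

(** The trivial coset is fixed by k, so the coset w is fixed by w^-1 k w. But k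
    moves the coset w. The cosets met on the way from the trivial one to w, and
    the image of w under k, are finitely many. *)
Lemma conjugate_detected (N : nat) (k : 'I_N) (w : word 'I_N) :
  reduced k w -> w <> [::] ->
  exists (T : finType) (e : 'I_N -> {perm T}), e k ^ eval_word e (rev w) <> e k.
Proof.
move=> nw w0; pose L := step k w (k, false) :: [seq drop i w | i <- iota 0 (size w).+1].
have suffix u v : w = u ++ v -> v \in L.
  move=> wE; rewrite inE; apply/orP; right; apply/mapP; exists (size u).
    by rewrite mem_iota /= wE size_cat; lia.
  by rewrite wE drop_size_cat.
have nL v : v \in L -> reduced k v.
  rewrite inE => /orP[/eqP->|/mapP[i _ ->]]; first exact: step_reduced.
  by apply: (@reduced_cat _ _ (take i w)); rewrite cat_take_drop.
have [e eP] := eval_letter_perm nL.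
have oL : [::] \in L by apply: (suffix w); rewrite cats0.
pose o : seq_sub L := SeqSub oL.
have reach u v : w = u ++ v -> val (eval_word e (rev v) o) = v.
  elim: v u => [|a v IHv] u wE /=; first by rewrite perm1.
  have wE' : w = rcons u a ++ v by rewrite cat_rcons.
  have nav : reduced k (a :: v) by apply: nL; apply: suffix wE.
  case/andP: (nav) => nv /eqP stepE.
  rewrite rev_cons -cats1 eval_cat permM /= mulg1 eP (IHv _ wE') ?stepE //.
  exact: suffix wE.
have reach_w := reach [::] w erefl.
exists (seq_sub L), e => fixed.
have eo : e k o = o.
  apply: val_inj; rewrite (eP (k, false)) /= ?eqxx //.
have := permJ (e k) (eval_word e (rev w)) o; rewrite fixed eo => /(congr1 val).
rewrite (eP (k, false)) reach_w ?mem_head //.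
by case: w w0 {nw nL suffix oL eP o reach reach_w eo e fixed L} => //= b w _;
  case: ifP => _ /(congr1 size) /=; lia.
Qed.

Section FiniteQuotients.
Variable m : nat.
Local Notation n := m.+2.
Local Notation W := (welded_braid_group n).
Local Notation iota := (@braid_of_perm m).
Local Notation pure_value := (@pure_value m).

(** Permutations permute the pure generators by conjugation, so they can be
    collected on the right. *)
Lemma pure_times_perm (g : W) : exists u x, g = word_value pure_value u * iota x.
Proof.
have closed (h : W) i j e : i != j -> (exists u x, h = word_value pure_value u * iota x) ->
    exists u x, h * alpha_sign i j e = word_value pure_value u * iota x.
  move=> ij [u [x ->]]; have ij' : x^-1 i != x^-1 j by rewrite (inj_eq perm_inj).
  exists (rcons u (pmove ij' e)), x; rewrite -cats1 word_value_cat /= mulg1 -!mulgA.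
  congr (_ * _); have E := alphaJ x ij'; rewrite !permKV in E.
  have -> : alpha_sign i j e = alpha_sign (x^-1 i) (x^-1 j) e ^ iota x.
    by rewrite /alpha_sign -E; case: e; rewrite ?conjVg.
  by rewrite /conjg mulgA mulgV mul1g.
have closed_rho (h : W) k : (exists u x, h = word_value pure_value u * iota x) ->
    exists u x, h * rho k = word_value pure_value u * iota x.
  by move=> [u [x ->]]; exists u, (x * swap k); rewrite braid_of_permM braid_of_swap mulgA.
elim/welded_ind: g => [|g k Hg|g k Hg|g k Hg]; last exact: closed_rho.
- by exists [::], 1; rewrite braid_of_perm1 mulg1.
- rewrite -[sigma k](mul_rhoK _ k) alpha_adjacent mulgA; apply: closed_rho.
  exact: (closed _ _ _ false (lo_neq_hi k)).
- rewrite -[sigma k](mul_rhoK _ k) alpha_adjacent invgM rhoV mulgA.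
  by apply: (closed _ _ _ true (lo_neq_hi k)); apply: closed_rho.
Qed.

Variable H : finGroupType.
Local Notation T := {ffun 'I_n -> H}.
Implicit Types t : T.

(** The entry at i moves to x i. With the inverse, products of permutations, which
    compose from left to right, act from left to right. *)
Definition perm_fun (x : {perm 'I_n}) t : T := [ffun i => t (x^-1 i)].
Definition alpha_fun (i j : 'I_n) t : T :=
  [ffun p => if p == i then t i ^ t j else t p].

Lemma perm_fun_inj x : injective (perm_fun x).
Proof.
move=> s t /ffunP st; apply/ffunP => i.
by have := st (x i); rewrite !ffunE permK.
Qed.

Lemma alpha_fun_inj i j : injective (alpha_fun i j).
Proof.
move=> s t /ffunP st; have [ij|ij] := eqVneq i j.
  apply/ffunP => p; have := st p; rewrite !ffunE -ij /conjg !mulKg.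
  by case: eqP => [->|].
have eqp p : p != i -> s p = t p.
  by move=> pi; have := st p; rewrite !ffunE (negPf pi).
apply/ffunP => p; have [->|/eqp//] := eqVneq p i.
have := st i; rewrite !ffunE eqxx (eqp j) 1?eq_sym //; exact: conjg_inj.
Qed.

Definition perm_act x : {perm T} := perm (@perm_fun_inj x).
Definition alpha_act i j : {perm T} := perm (@alpha_fun_inj i j).

Lemma perm_actE x t i : perm_act x t i = t (x^-1 i).
Proof. by rewrite permE ffunE. Qed.

Lemma alpha_actE i j t p : alpha_act i j t p = if p == i then t i ^ t j else t p.
Proof. by rewrite permE ffunE. Qed.

Lemma perm_actM x y : perm_act (x * y) = perm_act x * perm_act y.
Proof.
by apply/permP => t; apply/ffunP => i; rewrite permM !perm_actE invgM permM.
Qed.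

Lemma perm_act1 : perm_act 1 = 1.
Proof.
by apply/permP => t; apply/ffunP => i; rewrite perm_actE invg1 !perm1.
Qed.

Lemma perm_alpha_act x i j :
  perm_act x * alpha_act (x i) (x j) = alpha_act i j * perm_act x.
Proof.
apply/permP => t; apply/ffunP => p; rewrite !permM.
rewrite alpha_actE !perm_actE alpha_actE !permK.
by rewrite (canF_eq (permKV x)).
Qed.

Lemma alpha_act_comm i j k l : i != k -> j != k -> l != i ->
  commute (alpha_act i j) (alpha_act k l).
Proof.
move=> ik jk li; apply/permP => t; apply/ffunP => p; rewrite !permM !alpha_actE.
rewrite [k == i]eq_sym (negPf ik) (negPf jk) (negPf li).
by have [->|//] := eqVneq p k; rewrite eq_sym (negPf ik).
Qed.

Lemma alpha_act_triangle i j l : i != j -> i != l -> j != l ->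
  alpha_act i j * alpha_act i l * alpha_act j l =
  alpha_act j l * alpha_act i l * alpha_act i j.
Proof.
move=> ij il jl; apply/permP => t; apply/ffunP => p; rewrite !permM !alpha_actE.
rewrite ![l == _]eq_sym [j == i]eq_sym !(negPf ij) !(negPf il) !(negPf jl) !eqxx.
have [->|pi] := eqVneq p i; last by [].
by rewrite (negPf ij) conjJg.
Qed.

Definition generator_act (g : wb_gen n) : {perm T} :=
  match g with
  | inl k => alpha_act (lo k) (hi k) * perm_act (swap k)
  | inr k => perm_act (swap k)
  end.

Local Notation pa k := (perm_act (swap k)).
Local Notation aa k := (alpha_act (lo k) (hi k)).

Lemma push_alpha y k i j :
  y * pa k * alpha_act i j = y * alpha_act (swap k i) (swap k j) * pa k.
Proof.
rewrite -!mulgA -perm_alpha_act; congr (_ * (_ * alpha_act _ _)).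
  by rewrite /swap tpermK.
by rewrite /swap tpermK.
Qed.

(** Once the conjugations have been moved to the left of the permutations, every
    relation splits into a relation between conjugations and one between
    permutations. *)
Lemma generator_act_rel u v : wb_rel u v ->
  eval_word generator_act u = eval_word generator_act v.
Proof.
have pfar j k : far_apart j k -> pa j * pa k = pa k * pa j.
  by move=> jk; rewrite -!perm_actM (swap_far jk).
have pnear (j k : 'I_m.+1) : k = j.+1 :> nat -> forall y,
    y * pa j * pa k * pa j = y * pa k * pa j * pa k.
  by move=> jk y; rewrite -!mulgA -!perm_actM !mulgA (swap_near jk).
have farC (j k : 'I_m.+1) : far_apart j k -> far_apart k j by rewrite /far_apart orbC.
have aafar (j k : 'I_m.+1) : far_apart j k -> aa j * aa k = aa k * aa j.
  move=> jk; apply: alpha_act_comm; rewrite -val_eqE /= /bump /=;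
  by move: jk; rewrite /far_apart; lia.
have swapL k : swap k (lo k) = hi k by apply: tpermL.
have swapR k : swap k (hi k) = lo k by apply: tpermR.
have near_ne (j k : 'I_m.+1) : k = j.+1 :> nat ->
    [/\ lo j != hi j, lo j != hi k & hi j != hi k].
  by move=> jk; rewrite -!val_eqE /= /bump /= jk; split; lia.
case=> {u v}; rewrite /= /eval_letter /= => j.
- move=> k jk; rewrite !mulg1 !mulgA !push_alpha.
  have [-> ->] := swap_out jk; have [-> ->] := swap_out (farC _ _ jk).
  by rewrite (aafar _ _ jk) -!(mulgA (aa k * aa j)) (pfar _ _ jk).
- move=> k jk; have [ne1 ne2 ne3] := near_ne _ _ jk.
  have [e1 e2 e3 e4] := swap_hi_lo jk; have e5 := lo_hi_near jk.
  rewrite !mulg1 !mulgA e5 !push_alpha !(e1, e3, e4, swapL, swapR, e5).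
  by rewrite alpha_act_triangle // pnear.
- by rewrite !mulg1 -perm_actM swapK perm_act1.
- by move=> k jk; rewrite !mulg1 pfar.
- by move=> k jk; rewrite !mulg1 -[LHS]mul1g -[RHS]mul1g !mulgA pnear.
- move=> k jk; rewrite !mulg1 -[RHS]mul1g !mulgA push_alpha.
  by have [-> ->] := swap_out (farC _ _ jk); rewrite -!mulgA pfar // mul1g.
- move=> k jk; have [e1 e2 e3 e4] := swap_hi_lo jk; have e5 := lo_hi_near jk.
  rewrite !mulg1 -[LHS]mul1g !mulgA e5 !push_alpha !(e1, e3, e4, swapL, swapR, e5).
  by rewrite mul1g pnear.
- move=> k jk; have [ne1 ne2 ne3] := near_ne _ _ jk.
  have [e1 e2 e3 e4] := swap_hi_lo jk; have e5 := lo_hi_near jk.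
  rewrite !mulg1 -[LHS]mul1g !mulgA e5 !push_alpha !(e1, e3, e4, swapL, swapR, e5).
  rewrite mul1g pnear //; congr (_ * _ * _ * _).
  by apply: alpha_act_comm => //; rewrite eq_sym.
Qed.

Definition tuple_rep : W -> {perm T} := presented_hom generator_act.

Lemma tuple_repM : {morph tuple_rep : g h / g * h}.
Proof. exact: presented_homM generator_act_rel. Qed.

HB.instance Definition _ := isMultiplicative.Build W {perm T} tuple_rep tuple_repM.

Lemma tuple_repV g : tuple_rep g^-1 = (tuple_rep g)^-1.
Proof. exact: multiplicativeV. Qed.

Lemma tuple_rep_rho k : tuple_rep (rho k) = pa k.
Proof. exact: (presented_hom_gen generator_act_rel (inr k)). Qed.

Lemma tuple_rep_sigma k : tuple_rep (sigma k) = aa k * pa k.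
Proof. exact: (presented_hom_gen generator_act_rel (inl k)). Qed.

Lemma tuple_rep_perm x : tuple_rep (iota x) = perm_act x.
Proof.
elim/perm_ind_swap: x => [|x k IHx].
  by rewrite braid_of_perm1 perm_act1; apply: (multiplicative1 tuple_rep).
by rewrite braid_of_permM tuple_repM IHx braid_of_swap tuple_rep_rho perm_actM.
Qed.

Lemma tuple_rep_alpha i j : i != j -> tuple_rep (alpha i j) = alpha_act i j.
Proof.
move=> ij; rewrite alphaE /conjg !tuple_repM.
rewrite tuple_repV tuple_rep_perm tuple_rep_sigma tuple_rep_rho.
have [e0 e1] := alpha_permP ij; rewrite -[RHS](mulKg (perm_act (alpha_perm i j))).
congr (_ * _).
have := perm_alpha_act (alpha_perm i j) (pos0 m) (pos1 m); rewrite e0 e1 => ->.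
by rewrite -!mulgA (mulgA (pa _)) -perm_actM swapK perm_act1 mul1g.
Qed.

Variable e : 'I_n -> H.

(** The tuple of conjugates that w stands for, with the free generators
    specialised to e. *)
Definition evaluate (w : 'I_n -> word 'I_n) : T :=
  [ffun i => e i ^ eval_word e (rev (w i))].

(** An absorbed letter is a power of x_i, which commutes with x_i. *)
Lemma eval_step i z a :
  e i ^ eval_word e (rev (step i z a)) = e i ^ (eval_word e (rev z) * eval_letter e a).
Proof.
case: z => [|b z] /=.
  case: eqP => [<-|_]; rewrite /= mul1g ?mulg1 //.
  by case: a => x []; rewrite /eval_letter /conjg /= ?mulKg !gsimp.
case: eqP => [->|_]; rewrite !rev_cons -!cats1 !eval_cat /= mulg1 ?mulg1 //.
  by rewrite eval_inv_letter mulgVK.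
Qed.

Lemma eval_run i z u :
  e i ^ eval_word e (rev (run i z u)) = e i ^ (eval_word e (rev z) * eval_word e u).
Proof.
elim: u z => [|a u IHu] z /=; first by rewrite mulg1.
by rewrite IHu conjgM eval_step -conjgM mulgA.
Qed.

Lemma eval_loop j v (s : bool) : eval_word e (loop j v s) =
  eval_letter e (j, s) ^ eval_word e (rev v).
Proof.
rewrite /loop eval_cat /= /conjg; congr (_ * _).
elim: v => [|a v IHv]; first by rewrite invg1.
by rewrite rev_cons -cats1 eval_cat /= mulg1 invgM IHv eval_inv_letter.
Qed.

Lemma evaluate_conj_by w i j s : i != j -> reduced_tuple w ->
  evaluate (conj_by w i j s) = tuple_rep (alpha_sign i j s) (evaluate w).
Proof.
move=> ij rw; have pos w' : evaluate (conj_by w' i j false) = alpha_act i j (evaluate w').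
  apply/ffunP => p; rewrite alpha_actE !ffunE; have [->|pi] := eqVneq p i.
    by rewrite conj_byE eval_run eval_loop conjgM.
  by rewrite conj_by_neq.
case: s; last by rewrite pos tuple_rep_alpha.
have := pos (conj_by w i j true); rewrite (conj_byK true ij rw) => ->.
by rewrite /alpha_sign tuple_repV tuple_rep_alpha // permK.
Qed.

Lemma evaluate_moves w u : reduced_tuple w ->
  reduced_tuple (foldl (fun w s => move s w) w u) /\
  evaluate (foldl (fun w s => move s w) w u) =
    tuple_rep (word_value pure_value u) (evaluate w).
Proof.
elim: u w => [|[[[i j] /= ij] s] u IHu] w rw /=.
  by rewrite (multiplicative1 tuple_rep) perm1.
rewrite tuple_repM permM; have rw' := conj_by_reduced i j s rw.
have [? ->] := IHu _ rw'; split=> //.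
by rewrite /move /= evaluate_conj_by.
Qed.

End FiniteQuotients.

(** A nontrivial permutation part shows on a tuple with a single nontrivial entry.
    A pure braid other than 1 moves the tuple of the free generators, so one of
    its entries becomes a nontrivial conjugate, which a finite group detects. *)
Theorem welded_residually_finite m : residually_finite (welded_braid_group m.+2).
Proof.
move=> g g1; have [u [x gE]] := pure_times_perm g.
pose std : 'I_m.+2 -> word 'I_m.+2 := fun=> [::].
have rstd : reduced_tuple std by [].
pose w := foldl (fun w s => move s w) std u.
have tupleE (H : finGroupType) (e : 'I_m.+2 -> H) i :
    tuple_rep H g (evaluate e std) i = e (x^-1 i) ^ eval_word e (rev (w (x^-1 i))).
  rewrite gE tuple_repM permM tuple_rep_perm perm_actE.
  by have [_ <-] := evaluate_moves e u rstd; rewrite ffunE.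
have stdE (H : finGroupType) (e : 'I_m.+2 -> H) i : evaluate e std i = e i.
  by rewrite ffunE conjg1.
have detect (H : finGroupType) (e : 'I_m.+2 -> H) i :
    e (x^-1 i) ^ eval_word e (rev (w (x^-1 i))) <> e i ->
    exists (Q : finGroupType) (f : {multiplicative welded_braid_group m.+2 -> Q}), f g <> 1.
  move=> ne; exists {perm {ffun 'I_m.+2 -> H}}, (@tuple_rep m H) => /= rg1.
  by apply: ne; rewrite -tupleE rg1 perm1 stdE.
have [x1|x1] := pselect (x = 1); last first.
  have [i xi] : exists i, x^-1 i <> i.
    apply: contrapT => nx; apply: x1; apply: invg_inj; rewrite invg1.
    apply/permP => i; rewrite perm1; apply: contrapT => xi.
    by apply: nx; exists i.
  pose a : {perm bool} := tperm true false.
  have a1 : a <> 1 by move=> /permP /(_ true); rewrite tpermL perm1.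
  apply: (detect _ (fun j => if j == i then a else 1) i).
  by rewrite eqxx; case: eqP xi => // _ _; rewrite conj1g; apply: nesym.
have [w0|[k wk]] : w = std \/ exists k, w k <> [::].
  have [[k wk]|nw] := pselect (exists k, w k <> [::]); first by right; exists k.
  by left; apply/funext => k; apply: contrapT => wk; apply: nw; exists k.
  case: g1; rewrite gE x1 braid_of_perm1 mulg1.
  exact: pure_faithful rstd w0.
have rw : reduced_tuple w by have [] := @evaluate_moves _ {perm bool} (fun=> 1) std u rstd.
have [T [e ne]] := conjugate_detected (rw k) wk.
by apply: (detect _ e k); rewrite x1 invg1 perm1.
Qed.

(** * Finite generation of the commutator subgroup *)

Lemma generated_conj (G : groupType) (A B : G -> Prop) (y : G) :
  (forall x, A x -> generated B (x ^ y)) ->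
  forall x, generated A x -> generated B (x ^ y).
Proof.
move=> AB x; elim=> {x} [x /AB //||x z _ Bx _ Bz|x _ Bx].
- by rewrite conj1g; apply: Gen1.
- by rewrite conjMg; apply: GenM.
- by rewrite conjVg; apply: GenV.
Qed.

Lemma commg_mull (G : groupType) (x y z : G) : [~ x * y, z] = [~ x, z] ^ y * [~ y, z].
Proof. by rewrite /commg /conjg !invgM !mulgA !mulgK. Qed.

Lemma conj_split (G : groupType) (q s x y : G) : q * (x * y) * q^-1 =
  q * x * q^-1 * ((q * s^-1) * (s * y * s^-1) * (q * s^-1)^-1).
Proof. by rewrite invgM invgK !mulgA !mulgVK. Qed.

(** A quotient is abelian as soon as its generators commute. *)
Section QuotientAbelian.
Variables (G : groupType) (A B : G -> Prop).
Hypothesis B_gen : forall g, generated B g.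
Hypothesis A_normal : forall x y, generated A x -> generated A (x ^ y).

Let central_gen y : (forall x, B x -> generated A [~ x, y]) ->
  forall x, generated A [~ x, y].
Proof.
move=> By x; elim: (B_gen x) => {x} [x /By //||x z _ Ax _ Az|x _ Ax].
- by rewrite comm1g; apply: Gen1.
- by rewrite commg_mull; apply: GenM => //; apply: A_normal.
- have -> : [~ x^-1, y] = ([~ x, y]^-1) ^ x^-1.
    by rewrite /commg /conjg !invgM !invgK !mulgA mulgK.
  exact/A_normal/GenV.
Qed.

Lemma commutators_in_normal : (forall x y, B x -> B y -> generated A [~ x, y]) ->
  forall x y, generated A [~ x, y].
Proof.
move=> BB x y; apply: central_gen => {}x Bx.
rewrite -invgR; apply: GenV; apply: central_gen => {}y By; exact: BB.
Qed.

End QuotientAbelian.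

Section DerivedGeneration.
Variables (G : groupType) (E R : G -> Prop) (p t : G).

Inductive difference : G -> Prop :=
| Diff a b of E a & E b : difference (a * b^-1)
| DiffConj a b of E a & E b : difference (p * (a * b^-1) * p^-1)
| DiffR r of R r : difference r.
Local Notation K := (generated difference).

(** Up to the element c d^-1 of K, the square of a centralises a and b. For
    commuting a and b one takes z = a^2 and c = d. *)
Definition adjacent a b := exists z c d, [/\ E c, E d, a * a = z * (c * d^-1) &
  [/\ commute z (c * d^-1), commute z a & commute z b]].

Hypothesis Ep : E p.
Hypothesis E_connected : forall P : G -> Prop, P p ->
  (forall a b, E a -> E b -> adjacent a b -> P a -> P b) -> forall b, E b -> P b.
Hypothesis Rp : forall r, R r -> E (r * p * r^-1).
Hypothesis tt : t * t = 1.
Hypothesis Et : forall a, E a -> E (t * a * t).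
Hypothesis Rt : forall r, R r -> K (t * r * t).
Hypothesis G_gen : forall g, generated (fun z => [\/ K z, z = p | z = t]) g.

Let K1 : K 1. Proof. exact: Gen1. Qed.
Let KM x y : K x -> K y -> K (x * y). Proof. exact: GenM. Qed.
Let KV x : K x -> K x^-1. Proof. exact: GenV. Qed.
Let KJ x y : K x -> K y -> K (y * x * y^-1).
Proof. by move=> Kx Ky; apply: KM (KV Ky); apply: KM. Qed.
Let KJV x y : K x -> K y -> K (y^-1 * x * y).
Proof. by move=> Kx Ky; rewrite -{2}[y]invgK; apply: KJ => //; apply: KV. Qed.
Let KD a b : E a -> E b -> K (a * b^-1). Proof. by move=> Ea Eb; apply/GenIn/Diff. Qed.

Let KaD a b c : E a -> E b -> E c -> K (c * (a * b^-1) * c^-1).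
Proof.
move=> Ea Eb Ec; have -> : c * (a * b^-1) * c^-1 =
    (c * p^-1) * (p * (a * b^-1) * p^-1) * (c * p^-1)^-1.
  by rewrite invgM invgK !mulgA !mulgVK.
by apply: KJ; [apply/GenIn/DiffConj | apply: KD].
Qed.

Let Ksquare a b : E a -> E b -> K (a * a * (b * b)^-1).
Proof.
move=> Ea Eb; have -> : a * a * (b * b)^-1 = a * (a * b^-1) * a^-1 * (a * b^-1).
  by rewrite invgM !mulgA mulgVK.
by apply: KM; [apply: KaD | apply: KD].
Qed.

(** What spreads from p along adjacent elements, before K is known to be normal:
    p^2 K = b^2 K, and conjugation by p^2 and by its inverse keeps p b^-1 in
    K. *)
Let carried b := [/\ K ((p * p)^-1 * (b * b)),
  K (p * p * (p * b^-1) * (p * p)^-1) & K ((p * p)^-1 * (p * b^-1) * (p * p))].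

(** As a^2 is the product of z and an element of K, conjugation by a^2 keeps
    a b^-1 in K; and p^2 differs from a^2 by an element of K. *)
Let carried_adjacent a b : E a -> E b -> adjacent a b -> carried a -> carried b.
Proof.
move=> Ea Eb [z [c [d [Ec Ed a2 [zk za zb]]]]] [Ka1 Ka2 Ka3].
set k := c * d^-1 in a2 zk; have Kk : K k by apply: KD.
have zVk : k^-1 * z^-1 * k = z^-1 by rewrite -invgM zk invgM mulgVK.
have Kab : K (a * b^-1) by apply: KD.
have zx : commute z (a * b^-1) by apply: commuteM => //; apply: commuteV.
have conj_k y : commute z y -> (a * a) * y * (a * a)^-1 = k * y * k^-1.
  by move=> zy; rewrite a2 zk invgM !mulgA -(mulgA k z y) zy !mulgA mulgK.
have conj_kV y : commute z y -> (a * a)^-1 * y * (a * a) = k^-1 * y * k.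
  move=> zy; rewrite a2 invgM -!mulgA (mulgA y z k) -zy -!mulgA.
  by rewrite (mulgA z^-1) mulVg mul1g.
have Ksq : K ((a * a)^-1 * (b * b)).
  have zbb : commute (b * b) z^-1 by apply/commuteV/commute_sym/commuteM.
  have -> : (a * a)^-1 * (b * b) = k^-1 * (b * b * (a * a)^-1) * k.
    by rewrite a2 invgM -[LHS]mulgA -zbb -[in LHS]zVk !mulgA.
  by apply: KJV => //; apply: Ksquare.
have Kxab : K ((a * a) * (a * b^-1) * (a * a)^-1) by rewrite conj_k //; apply: KJ.
have KxabV : K ((a * a)^-1 * (a * b^-1) * (a * a)) by rewrite conj_kV //; apply: KJV.
have pb : p * b^-1 = p * a^-1 * (a * b^-1) by rewrite mulgA mulgVK.
split.
- by rewrite -[b * b](mulVKg (a * a)) mulgA; apply: KM.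
- rewrite pb (conj_split _ (a * a)).
  by apply: KM => //; apply: KJ => //; apply: Ksquare.
- rewrite pb; have := conj_split (p * p)^-1 (a * a)^-1 (p * a^-1) (a * b^-1).
  by rewrite !invgK => ->; apply: KM => //; apply: KJ.
Qed.

Let carried_all b : E b -> carried b.
Proof.
apply: E_connected; last exact: carried_adjacent.
by split; rewrite ?mulVg // ?mulgV ?mulg1 ?mulgV ?mulVg.
Qed.

Let K_square a b : E a -> E b ->
  K (p * p * (a * b^-1) * (p * p)^-1) /\ K ((p * p)^-1 * (a * b^-1) * (p * p)).
Proof.
move=> /carried_all[_ Ka KVa] /carried_all[_ Kb KVb].
have ab : a * b^-1 = (p * a^-1)^-1 * (p * b^-1).
  by rewrite invgM invgK !mulgA mulgVK.
split; rewrite ab.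
  have -> : p * p * ((p * a^-1)^-1 * (p * b^-1)) * (p * p)^-1 =
     (p * p * (p * a^-1) * (p * p)^-1)^-1 * (p * p * (p * b^-1) * (p * p)^-1).
    by rewrite !invgM !invgK !mulgA !mulgVK.
  by apply: KM => //; apply: KV.
have -> : (p * p)^-1 * ((p * a^-1)^-1 * (p * b^-1)) * (p * p) =
   ((p * p)^-1 * (p * a^-1) * (p * p))^-1 * ((p * p)^-1 * (p * b^-1) * (p * p)).
  by rewrite !invgM !invgK !mulgA !mulgK.
by apply: KM => //; apply: KV.
Qed.

Let conj_pV x : K x -> K (x ^ p^-1).
Proof.
apply: generated_conj => {}x; rewrite /conjg invgK mulgA; case=> [a b Ea Eb|a b Ea Eb|r Rr].
- exact/GenIn/DiffConj.
- have [] := K_square Ea Eb; rewrite invgM !mulgA //.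
- have -> : p * r * p^-1 = p * (r * p * r^-1)^-1 * r.
    by rewrite !invgM invgK !mulgA mulgVK.
  by apply: KM; [apply: KD => //; apply: Rp | apply/GenIn/DiffR].
Qed.

Let conj_p x : K x -> K (x ^ p).
Proof.
have Dp a b : E a -> E b -> K (p^-1 * (a * b^-1) * p).
  move=> Ea Eb; have [_ /conj_pV] := K_square Ea Eb.
  by rewrite /conjg invgK invgM !mulgA mulgV mul1g mulgK.
apply: generated_conj => {}x; rewrite /conjg mulgA; case=> [a b Ea Eb|a b Ea Eb|r Rr].
- exact: Dp.
- by rewrite !mulgA mulVg mul1g mulgVK -?mulgA; apply: KD.
- have -> : p^-1 * r * p = p^-1 * (r * p * r^-1 * p^-1) * p * r.
    by rewrite !mulgA !mulgVK.
  by apply: KM; [apply: Dp => //; apply: Rp | apply/GenIn/DiffR].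
Qed.

Let tV : t^-1 = t. Proof. exact: mulg1_eq. Qed.

Let conj_t x : K x -> K (x ^ t).
Proof.
apply: generated_conj => {}x; rewrite /conjg tV mulgA.
have D a b : E a -> E b -> t * (a * b^-1) * t = (t * a * t) * (t * b * t)^-1.
  by move=> _ _; rewrite !invgM tV !mulgA -(mulgA _ t t) tt mulg1.
case=> [a b Ea Eb|a b Ea Eb|r Rr].
- by rewrite D //; apply: KD; apply: Et.
- have -> : t * (p * (a * b^-1) * p^-1) * t =
      (t * p * t) * ((t * a * t) * (t * b * t)^-1) * (t * p * t)^-1.
    rewrite -D // !invgM tV !mulgA -(mulgA _ t t) tt mulg1.
    by rewrite -(mulgA _ t t) tt mulg1.
  by apply: KaD; apply: Et.
- exact: Rt.
Qed.

Let K_normal x y : K x -> K (x ^ y).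
Proof.
suff : forall x, K x -> K (x ^ y) /\ K (x ^ y^-1) by move=> /[apply] -[].
elim: (G_gen y) => {x y}.
- move=> y [Ky|->|->] x Kx.
  + by rewrite /conjg invgK !mulgA; split; [apply: KJV | apply: KJ].
  + by split; [apply: conj_p | apply: conj_pV].
  + by rewrite tV; split; apply: conj_t.
- by move=> x; rewrite invg1 conjg1.
- move=> y z _ Hy _ Hz x Kx; rewrite invgM !conjgM.
  by have [Ky _] := Hy _ Kx; have [_ Kz] := Hz _ Kx; split; [apply: (Hz _ Ky).1 | apply: (Hy _ Kz).2].
- by move=> y _ Hy x Kx; rewrite invgK; have [] := Hy _ Kx.
Qed.

(** The conjugates of K by p, its inverse and t lie in K, so K is normal; modulo K
    the group is generated by p and t, which commute since t p t is in E. *)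
Theorem derived_generated x y : K [~ x, y].
Proof.
apply: (commutators_in_normal G_gen) => {x y} [x y|x y]; first exact: K_normal.
have Kl a b : K a -> K [~ a, b].
  by move=> Ka; rewrite commgEl; apply: KM; [apply: KV | apply: K_normal].
have Kr a b : K b -> K [~ a, b] by move=> Kb; rewrite -invgR; apply/KV/Kl.
have Kpt : K [~ p, t].
  rewrite commgEl; have -> : p^-1 * p ^ t = (t * p * t * p^-1) ^ p.
    by rewrite /conjg tV mulgVK !mulgA.
  by apply: conj_p; apply: KD => //; apply: Et.
case=> [Kx _|->|->]; first exact: Kl.
- by case=> [Ky|->|->]; [apply: Kr | rewrite commgg |].
- by case=> [Ky|->|->]; [apply: Kr | rewrite -invgR; apply: KV | rewrite commgg].
Qed.

End DerivedGeneration.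

Lemma finitely_generated_derived (G : groupType) (L : seq G) :
  (forall x, x \in L -> exists y z, x = [~ y, z]) ->
  (forall x y, generated (fun z => z \in L) [~ x, y]) ->
  finitely_generated (commutator_subgroup G).
Proof.
move=> Lc cL.
have Ld x : x \in L -> x \in @derived G by move=> /Lc H; apply/asboolP/GenIn.
pose L' : seq (commutator_subgroup G) := pmap insub L.
have lift x : generated (fun z => z \in L) x ->
    exists2 u : commutator_subgroup G, val u = x & generated (fun z => z \in L') u.
  elim=> {x} [x xL||x y _ [u <- Lu] _ [v <- Lv]|x _ [u <- Lu]].
  - exists (Sub x (Ld _ xL)); first exact: SubK.
    by apply: GenIn; rewrite mem_pmap_sub.
  - by exists 1; [apply: val1 | apply: Gen1].
  - by exists (u * v); [apply: valM | apply: GenM].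
  - by exists (u^-1); [apply: gmulfV | apply: GenV].
exists L' => x; have : generated (fun z => z \in L) (val x).
  have /asboolP := valP x; elim=> {x} [x [y [z ->]]||x y _ Lx _ Ly|x _ Lx].
  - exact: cL.
  - exact: Gen1.
  - exact: GenM.
  - exact: GenV.
by move=> /lift[u /val_inj <-].
Qed.

Section WeldedDerived.
Variable m : nat.
Local Notation n := m.+3.
Local Notation W := (welded_braid_group n).
Local Notation iota := (@braid_of_perm m.+1).

Definition is_alpha (a : W) := exists i j, i != j /\ a = alpha i j.
Definition is_rho_pair (r : W) := exists j k : 'I_m.+2, r = rho j * rho k.

Lemma third_position (i j : 'I_n) : exists k, k != i /\ k != j.
Proof.
have : (0 < #|~: [set i; j]|)%N.
  by have := cardsC [set i; j]; rewrite card_ord cards2; case: (i != j) => /=; lia.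
by case/card_gt0P=> k; rewrite !inE negb_or => /andP[]; exists k.
Qed.

Lemma is_alphaP i j : i != j -> is_alpha (alpha i j).
Proof. by exists i, j. Qed.

(** Pure generators with the same target commute; those with the same source
    are linked through the product that conjugates two strands at once. *)
Lemma alpha_connected (P : W -> Prop) : P (alpha (pos0 _) (pos1 _)) ->
  (forall a b, is_alpha a -> is_alpha b -> adjacent is_alpha a b -> P a -> P b) ->
  forall b, is_alpha b -> P b.
Proof.
move=> P0 Padj.
have target i j k : i != j -> k != j -> P (alpha i j) -> P (alpha k j).
  move=> ij kj; have [<-//|ik] := eqVneq i k.
  apply: Padj; try exact: is_alphaP.
  exists (alpha i j * alpha i j), (alpha i j), (alpha i j).
  rewrite mulgV mulg1; split; try exact: is_alphaP; first by [].
  have c := alpha_same_target ik ij kj.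
  split; [exact: commute1 | exact/commute_sym/commuteM |].
  exact/commute_sym/commuteM/commute_sym/c.
have source i j k : i != j -> i != k -> P (alpha i j) -> P (alpha i k).
  move=> ij ik; have [<-//|jk] := eqVneq j k.
  apply: Padj; try exact: is_alphaP.
  have kj : k != j by rewrite eq_sym.
  have c := alpha_same_target ik ij kj.
  exists (alpha i j * alpha k j), (alpha i j), (alpha k j).
  split; try exact: is_alphaP.
    by rewrite -!mulgA; congr (_ * _); rewrite mulgA -c mulgK.
  have z1 : commute (alpha i j * alpha k j) (alpha i j).
    by apply/commute_sym/commuteM => //; apply: commute_refl.
  have z2 : commute (alpha i j * alpha k j) (alpha k j).
    by apply/commute_sym/commuteM; [apply: commute_sym | apply: commute_refl].
  split=> //; first exact/commuteM/commuteV.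
  exact: alpha_triangle.
move=> b [k [l [kl ->]]]; move: P0; have := lo_neq_hi (ord0 : 'I_m.+2).
rewrite -/(pos0 _) -/(pos1 _); move: (pos0 _) (pos1 _) => i j ij Pij.
have [kj|kj] := eqVneq k j; last by apply: (source k j) => //; apply: (target i).
have [r [ri rj]] := third_position i j; subst k.
apply: (source j r) => //; first by rewrite eq_sym.
apply: (target i) => //; [by rewrite eq_sym|by rewrite eq_sym|].
by apply: (source i j) => //; rewrite eq_sym.
Qed.

Lemma alpha_conjugate i j k l : i != j -> k != l ->
  exists g : W, alpha k l = alpha i j ^ g.
Proof.
move=> ij kl; have u1 : uniq [:: i; j] by rewrite /= inE ij.
have u2 : uniq [:: k; l] by rewrite /= inE kl.
have [x [xi xj]] := perm_extension u1 u2 erefl.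
by exists (iota x); rewrite alphaJ // xi xj.
Qed.

Lemma rho_conjugate (j k : 'I_m.+2) : exists g : W, rho k = rho j ^ g.
Proof.
have u (h : 'I_m.+2) : uniq [:: lo h; hi h] by rewrite /= inE lo_neq_hi.
have [x [xi xj]] := perm_extension (u j) (u k) erefl.
exists (iota x); rewrite -!braid_of_swap /swap -xi -xj -tpermJ /conjg.
by rewrite !braid_of_permM braid_of_permV.
Qed.

(** All pure generators are conjugate to each other, and so are all rho's; the
    quotient of two conjugate elements is a commutator. *)
Lemma difference_commutator x :
  difference is_alpha is_rho_pair (alpha (pos0 _) (pos1 _)) x ->
  exists y z : W, x = [~ y, z].
Proof.
have diff a b : is_alpha a -> is_alpha b -> exists g, a * b^-1 = [~ a^-1, g].
  move=> [i [j [ij ->]]] [k [l [kl ->]]]; have [g ->] := alpha_conjugate ij kl.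
  by exists g; rewrite commgEl invgK conjVg.
case=> {x} [a b /diff H /H[g ->]|a b /diff H /H[g ->]|r [j [k ->]]].
- by exists a^-1, g.
- set p := alpha _ _; exists (a^-1 ^ p^-1), (g ^ p^-1).
  by rewrite -conjRg [RHS]conjgE invgK; apply: esym; apply: mulgA.
- have [g ->] := rho_conjugate j k; exists (rho j), g.
  by rewrite commgEl rhoV.
Qed.

Lemma difference_finite : exists L : seq W, forall x,
  difference is_alpha is_rho_pair (alpha (pos0 _) (pos1 _)) x <-> x \in L.
Proof.
pose As : seq W := [seq alpha q.1 q.2 | q <- enum {: 'I_n * 'I_n} & q.1 != q.2].
have AsP a : a \in As <-> is_alpha a.
  split=> [/mapP[[i j]]|[i [j [ij ->]]]].
    by rewrite mem_filter => /andP[ij _] ->; exists i, j.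
  by apply/mapP; exists (i, j); rewrite // mem_filter ij mem_enum.
set p := alpha _ _.
pose D := [seq a * b^-1 | a <- As, b <- As].
pose Rs : seq W := [seq rho j * rho k | j <- enum 'I_m.+2, k <- enum 'I_m.+2].
exists (D ++ [seq p * d * p^-1 | d <- D] ++ Rs) => x; rewrite !mem_cat; split.
  case=> [a b /AsP a_in /AsP b_in|a b /AsP a_in /AsP b_in|r [j [k ->]]].
  - by apply/or3P/Or31/allpairs_f.
  - by apply/or3P/Or32/map_f/allpairs_f.
  - by apply/or3P/Or33/allpairs_f; rewrite mem_enum.
case/or3P=> [/allpairsP[[a b] [/AsP Ea /AsP Eb ->]]|/mapP[d]|/allpairsP[[j k] [_ _ ->]]].
- exact: Diff.
- by case/allpairsP=> -[a b] [/AsP Ea /AsP Eb ->] ->; apply: DiffConj.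
- by apply: DiffR; exists j, k.
Qed.

Theorem welded_derived_finitely_generated :
  finitely_generated (commutator_subgroup W).
Proof.
have [L LP] := difference_finite.
apply: (@finitely_generated_derived _ L) => [x /LP|x y]; first exact: difference_commutator.
set A := difference _ _ _ in LP.
have : generated A [~ x, y].
  apply: (@derived_generated _ _ _ _ (rho ord0)).
  - exact/is_alphaP/lo_neq_hi.
  - exact: alpha_connected.
  - move=> r [j [k ->]]; set p := alpha _ _.
    have -> : rho j * rho k * p * (rho j * rho k)^-1 = p ^ iota (swap k * swap j).
      by rewrite braid_of_permM !braid_of_swap /conjg !invgM !rhoV !mulgA.
    rewrite alphaJ ?lo_neq_hi //; apply: is_alphaP.
    by rewrite (inj_eq perm_inj) lo_neq_hi.
  - exact: rhoK.
  - move=> a [i [j [ij ->]]]; have := alphaJ (swap ord0) ij.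
    rewrite braid_of_swap /conjg rhoV mulgA => ->; apply: is_alphaP.
    by rewrite (inj_eq perm_inj).
  - move=> r [j [k ->]]; have -> : rho ord0 * (rho j * rho k) * rho ord0 =
        (rho ord0 * rho j) * (rho k * rho ord0) by rewrite !mulgA.
    by apply: GenM; apply/GenIn/DiffR; [exists ord0, j | exists k, ord0].
  set p := alpha _ _; set B := fun z => _.
  have gen_rho k : generated B (rho k).
    rewrite -(mul_rhoK (rho k) ord0); apply: GenM; apply: GenIn; last exact: Or33.
    by apply/Or31/GenIn/DiffR; exists k, ord0.
  have gen_sigma k : generated B (sigma k).
    rewrite -(mul_rhoK (sigma k) k) alpha_adjacent; apply: GenM => //.
    rewrite -(mulgVK p (alpha _ _)); apply: GenM; apply: GenIn; last exact: Or32.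
    by apply/Or31/GenIn/Diff; apply: is_alphaP; apply: lo_neq_hi.
  elim/welded_ind=> [|g k Hg|g k Hg|g k Hg]; first exact: Gen1.
  - exact: GenM.
  - exact/GenM/GenV.
  - exact: GenM.
elim=> [z /LP zL||z1 z2 _ H1 _ H2|z _ Hz].
- exact: GenIn.
- exact: Gen1.
- exact: GenM.
- exact: GenV.
Qed.

End WeldedDerived.

(** * The commutator subgroup is Hopfian *)

Lemma residually_finite_derived (G : groupType) :
  residually_finite G -> residually_finite (commutator_subgroup G).
Proof.
move=> rfG x x1; have [|Q [f fx]] := rfG (val x).
  by move=> vx; apply/x1/val_inj; rewrite vx; apply: esym; apply: val1.
by exists Q, (f \o (val : {multiplicative commutator_subgroup G -> G})).
Qed.

Theorem corollary1p2 (n : nat) (hn : 3 <= n) :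
  hopfian (commutator_subgroup (welded_braid_group n)).
Proof.
case: n hn => [|[|[|m]]] // _; apply: malcev_hopfian.
  exact: welded_derived_finitely_generated.
exact/residually_finite_derived/welded_residually_finite.
Qed.
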